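(* Let $\Lambda$ be an Artin algebra, let $X$ be an additive generator in $\operatorname{mod}(\Lambda)$, $F:=F_{\operatorname{add}(X)}$ and $\Gamma:=\operatorname{End}_\Lambda(X)^{op}$. Then, for any $M\in\operatorname{mod}(\Lambda)$, the following statements are equivalent. (a) $M$ is $F$-presilting. (b) $\operatorname{Hom}_\Lambda(\pi^{-2}_{F,M},M)=0$ and $\operatorname{Ext}^1_F(M,M)=0$. (c) $\operatorname{Hom}_\Lambda(\pi^{-2}_{F,M},M)=0$ and $\operatorname{Ext}^1_F(M,Z)=0$ for all $Z\in\operatorname{gen}_F(M)$. (d) $\operatorname{Hom}_\Lambda(X,M)$ is $\tau$-rigid in $\operatorname{mod}(\Gamma)$.
   Context: $\operatorname{mod}(\Lambda)$ is the category of finitely generated left $\Lambda$-modules. $\operatorname{add}(M)$ is the class of direct summands of finite direct sums of copies of $M$; $\operatorname{gen}(M)$ is the class of epimorphic images of finite direct sums of copies of $M$. An additive generator in $\operatorname{mod}(\Lambda)$ is a module $X$ with $\operatorname{gen}(X)=\operatorname{mod}(\Lambda)$. $F_{\operatorname{add}(X)}$ is the additive subfunctor of $\operatorname{Ext}^1_\Lambda$ such that $F_{\operatorname{add}(X)}(C,A)$ consists of the exact sequences $\eta:0\to A\to B\to C\to 0$ with $\operatorname{Hom}_\Lambda(Z,\eta)$ exact for all $Z\in\operatorname{add}(X)$; these sequences are called $F$-exact. The $F$-projective modules (those $P$ with $\operatorname{Hom}_\Lambda(P,\eta)$ exact for every $F$-exact $\eta$) are exactly those in $\operatorname{add}(X)$,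 and $F$ has enough projectives. $\operatorname{Ext}^i_F(M,N)$ is the $i$-th cohomology of $\operatorname{Hom}_\Lambda(P_\bullet,N)$, where $P_\bullet$ is an $F$-projective resolution of $M$ (a resolution by $F$-projectives whose constituent short exact sequences are $F$-exact). $\operatorname{gen}_F(M)$ is the class of all $Z$ admitting an $F$-exact sequence $0\to K\to Y\to Z\to 0$ with $Y$ a finite direct sum of copies of $M$. For each $M$ fix a minimal $F$-projective resolution $\cdots\to P^{-2}_F(M)\xrightarrow{\pi^{-2}_{F,M}}P^{-1}_F(M)\xrightarrow{\pi^{-1}_{F,M}}P^0_F(M)\xrightarrow{\pi^0_{F,M}}M\to 0$ (minimal: each map onto its image is right minimal). $\operatorname{Hom}_\Lambda(\pi^{-2}_{F,M},M):\operatorname{Hom}_\Lambda(P^{-1}_F(M),M)\to\operatorname{Hom}_\Lambda(P^{-2}_F(M),M)$ is precomposition with $\pi^{-2}_{F,M}$. $P^\bullet_{F\ge -1}(M)$ denotes the cochain complex $P^{-1}_F(M)\xrightarrow{\pi^{-1}_{F,M}}P^0_F(M)$ concentrated in degrees $-1$ and $0$. A complex $P^\bullet$ in the bounded homotopy category $\mathsf{K}^b(\operatorname{add}(X))$ is presilting if $\operatorname{Hom}_{\mathsf{K}^b(\operatorname{add}(X))}(P^\bullet,P^\bullet[i])=0$ for all $i>0$. $M$ is $F$-presilting if $P^\bullet_{F\ge -1}(M)$ is presilting in $\mathsf{K}^b(\operatorname{add}(X))$. A $\Gamma$-module $N$ is $\tau$-rigid if $\operatorname{Hom}_\Gamma(N,\tau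 N)=0$, where $\tau$ is the Auslander–Reiten translation. *)

(* Defs.v *)
From HB Require Import structures.
From mathcomp Require Import all_boot all_order all_algebra.
From mathcomp Require Import boolp.

Set Implicit Arguments.
Unset Strict Implicit.
Unset Printing Implicit Defensive.

Import GRing.Theory.
Local Open Scope ring_scope.

(* Rings are [pzRingType]s (1 = 0 is allowed), so that the zero algebra and the
   endomorphism ring of the zero module are covered; this rules out [algType],
   so an R-algebra is a ring with a morphism from [R] to its centre.
   Left modules over [A] are [lmodType A], right modules over [A] are
   [lmodType A^c]. *)

Section LinearZmodule.
Variables (A : pzRingType) (U V : lmodType A).

HB.instance Definition _ := gen_eqMixin {linear U -> V}.
HB.instance Definition _ := gen_choiceMixin {linear U -> V}.

Lemma linear_ext (f g : {linear U -> V}) : f =1 g -> f = g.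
Proof.
move=> fg; case: f g fg => [f cf] [g cg] /= /funext fg.
case: _ / fg in cg *; congr GRing.Linear.Pack.
case: cf cg => [[fA] [fZ]] [[gA] [gZ]].
by rewrite (Prop_irrelevance fA gA) (Prop_irrelevance fZ gZ).
Qed.

Definition lin_zero : {linear U -> V} := \0.
Definition lin_opp (f : {linear U -> V}) : {linear U -> V} := \- f.
Definition lin_add (f g : {linear U -> V}) : {linear U -> V} := f \+ g.

Fact lin_addA : associative lin_add.
Proof. by move=> f g h; apply: linear_ext => x /=; rewrite addrA. Qed.
Fact lin_addC : commutative lin_add.
Proof. by move=> f g; apply: linear_ext => x /=; rewrite addrC. Qed.
Fact lin_add0 : left_id lin_zero lin_add.
Proof. by move=> f; apply: linear_ext => x /=; rewrite add0r. Qed.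
Fact lin_addN : left_inverse lin_zero lin_opp lin_add.
Proof. by move=> f; apply: linear_ext => x /=; rewrite addNr. Qed.

HB.instance Definition _ := GRing.isZmodule.Build {linear U -> V}
  lin_addA lin_addC lin_add0 lin_addN.
End LinearZmodule.

Section Modules.
Variable A : pzRingType.
Implicit Types U V W M N P X Z J : lmodType A.

Definition fg M : Prop :=
  exists (n : nat) (s : 'I_n -> M),
    forall x, exists c : 'I_n -> A, x = \sum_(i < n) c i *: s i.

(* [n] copies of [M]; for [n = 0] it is the zero module. *)
Definition copies M (n : nat) : lmodType A := {ffun 'I_n -> M}.

Definition isomorphic U V : Prop := exists f : {linear U -> V}, bijective f.

Definition in_add M Z : Prop :=
  exists (n : nat) (N : lmodType A), isomorphic (copies M n) (Z * N)%type.

Definition in_gen M Z : Prop :=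
  exists (n : nat) (f : {linear copies M n -> Z}), forall z, exists y, f y = z.

Definition additive_generator X : Prop := fg X /\ (forall Z, in_gen X Z <-> fg Z).

Definition right_minimal U V (g : {linear U -> V}) : Prop :=
  forall h : {linear U -> U}, (forall x, g (h x) = g x) -> bijective h.

Definition exact_at U V W (f : {linear U -> V}) (g : {linear V -> W}) : Prop :=
  forall y, g y = 0 <-> exists x, f x = y.

Definition short_exact U V W (f : {linear U -> V}) (g : {linear V -> W}) : Prop :=
  [/\ injective f, exact_at f g & forall z, exists y, g y = z].

Definition submodule M (S : M -> Prop) : Prop :=
  S 0 /\ forall (a : A) x y, S x -> S y -> S (a *: x + y).

Definition projective P : Prop :=
  forall U V (g : {linear U -> V}) (u : {linear P -> V}),
    (forall z, exists y, g y = z) ->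
    exists v : {linear P -> U}, forall x, g (v x) = u x.

Definition injective_module J : Prop :=
  forall U V (f : {linear U -> V}) (u : {linear U -> J}),
    injective f -> exists v : {linear V -> J}, forall x, v (f x) = u x.

Definition injective_envelope M J (i : {linear M -> J}) : Prop :=
  [/\ injective_module J, injective i &
      forall S : J -> Prop, submodule S -> (exists2 y, S y & y <> 0) ->
        exists2 x, S (i x) & x <> 0].

End Modules.

Section QuotientModule.
Variables (A : pzRingType) (V : lmodType A) (S : V -> Prop).
Hypothesis subS : submodule S.

Definition subm_pred : {pred V} := fun v => `[< S v >].

Fact subm_zmod_closed : zmod_closed subm_pred.
Proof.
case: subS => S0 SP; split=> [|x y /asboolP Sx /asboolP Sy]; apply/asboolP=> //.
by rewrite addrC -scaleN1r; apply: SP.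
Qed.
HB.instance Definition _ := GRing.isZmodClosed.Build V subm_pred subm_zmod_closed.

Definition quotmod : Type := Quotient.quot subm_pred.
HB.instance Definition _ := GRing.Zmodule.on quotmod.

Local Open Scope quotient_scope.
Local Notation piq := (\pi_(Quotient.quot subm_pred)).

Definition quot_scale (a : A) (x : quotmod) : quotmod := piq (a *: repr x).

Lemma quot_scale_pi a x : quot_scale a (piq x) = piq (a *: x).
Proof.
apply/eqP; rewrite /quot_scale -Quotient.idealrBE -scalerBr; apply/asboolP.
have /asboolP Sx : subm_pred (repr (piq x) - x).
  by rewrite -[subm_pred _]/(_ \in subm_pred) Quotient.idealrBE reprK.
rewrite -[_ *: _]addr0; case: subS => S0; apply=> //.
Qed.

Lemma quot_surj (x : quotmod) : exists v, x = piq v.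
Proof. by exists (repr x); rewrite reprK. Qed.

Lemma pi_addE u v : (piq u : quotmod) + piq v = piq (u + v).
Proof. by rewrite Quotient.pi_add. Qed.

Fact quot_scaleA a b x : quot_scale a (quot_scale b x) = quot_scale (a * b) x.
Proof. by have [v ->] := quot_surj x; rewrite !quot_scale_pi scalerA. Qed.
Fact quot_scale1 : left_id 1 quot_scale.
Proof. by move=> x; have [v ->] := quot_surj x; rewrite quot_scale_pi scale1r. Qed.
Fact quot_scaleDr : right_distributive quot_scale +%R.
Proof.
move=> a x y; have [u ->] := quot_surj x; have [v ->] := quot_surj y.
by rewrite pi_addE !quot_scale_pi pi_addE scalerDr.
Qed.
Fact quot_scaleDl x : {morph quot_scale^~ x : a b / a + b}.
Proof.
move=> a b; have [v ->] := quot_surj x.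
by rewrite !quot_scale_pi pi_addE scalerDl.
Qed.
HB.instance Definition _ := GRing.Zmodule_isLmodule.Build A quotmod
  quot_scaleA quot_scale1 quot_scaleDr quot_scaleDl.
End QuotientModule.

Section Cokernel.
Variables (A : pzRingType) (U V : lmodType A) (f : {linear U -> V}).

Definition im : V -> Prop := fun y => exists x, f x = y.

Fact im_submodule : submodule im.
Proof.
split=> [|a _ _ [x <-] [y <-]]; first by exists 0; rewrite linear0.
by exists (a *: x + y); rewrite linearP.
Qed.

Definition coker : lmodType A := quotmod im_submodule.
End Cokernel.

Section Radical.
Variable R : comPzRingType.

Definition ideal (I : R -> Prop) : Prop := submodule (I : R^o -> Prop).

Definition maximal_ideal (I : R -> Prop) : Prop :=
  [/\ ideal I, ~ I 1 &
      forall K : R -> Prop, ideal K -> ~ K 1 ->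
        (forall r, I r -> K r) -> forall r, K r -> I r].

Definition rad : R^o -> Prop :=
  fun r => forall I : R -> Prop, maximal_ideal I -> I r.

Fact rad_submodule : submodule rad.
Proof.
split=> [I [] [] //|a x y rx ry I maxI].
by case: (maxI) => [[_ IP] _ _]; apply: IP; [apply: rx|apply: ry].
Qed.

(* [R / rad R] as an [R]-module *)
Definition Rtop : lmodType R := quotmod rad_submodule.

Definition artinian : Prop :=
  forall I : nat -> R -> Prop, (forall n, ideal (I n)) ->
    (forall n r, I n.+1 r -> I n r) ->
    exists N, forall n, (N <= n)%N -> forall r, I N r -> I n r.
End Radical.

Record alg_str (R : comPzRingType) (A : pzRingType) := AlgStr {
  alg_map :> {rmorphism R -> A};
  alg_mapC : forall r a, alg_map r * a = a * alg_map r
}.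

(* [V] as an [R]-module, through [phi] *)
Definition restr (R : comPzRingType) (A : pzRingType) (phi : alg_str R A)
  (V : lmodType A) : Type := V.

Section RestrictScalars.
Variables (R : comPzRingType) (A : pzRingType) (phi : alg_str R A).
Variable V : lmodType A.
Local Notation restr V := (restr phi V).

HB.instance Definition _ := GRing.Zmodule.on (restr V).
Definition restr_scale (r : R) (v : restr V) : restr V := phi r *: (v : V).

Fact restr_scaleA a b v : restr_scale a (restr_scale b v) = restr_scale (a * b) v.
Proof. by rewrite /restr_scale scalerA rmorphM. Qed.
Fact restr_scale1 : left_id 1 restr_scale.
Proof. by move=> v; rewrite /restr_scale rmorph1 scale1r. Qed.
Fact restr_scaleDr : right_distributive restr_scale +%R.
Proof. by move=> r u v; rewrite /restr_scale scalerDr. Qed.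
Fact restr_scaleDl v : {morph restr_scale^~ v : a b / a + b}.
Proof. by move=> a b; rewrite /restr_scale rmorphD scalerDl. Qed.
HB.instance Definition _ := GRing.Zmodule_isLmodule.Build R (restr V)
  restr_scaleA restr_scale1 restr_scaleDr restr_scaleDl.
End RestrictScalars.

Definition artin_algebra (R : comPzRingType) (A : pzRingType)
    (phi : alg_str R A) : Prop :=
  artinian R /\ fg (restr phi A^o : lmodType R).

Section OppositeAlgebra.
Variables (R : comPzRingType) (A : pzRingType) (phi : alg_str R A).

Definition opp_map (r : R) : A^c := phi r.
Fact opp_map_zmod : zmod_morphism opp_map.
Proof. by move=> r s; rewrite /opp_map rmorphB. Qed.
Fact opp_map_monoid : monoid_morphism opp_map.
Proof.
by split=> [|r s]; rewrite /opp_map ?rmorph1 // rmorphM alg_mapC.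
Qed.
HB.instance Definition _ := GRing.isZmodMorphism.Build R A^c opp_map opp_map_zmod.
HB.instance Definition _ := GRing.isMonoidMorphism.Build R A^c opp_map opp_map_monoid.

Fact opp_mapC (r : R) (a : A^c) : opp_map r * a = a * opp_map r.
Proof. exact: esym (alg_mapC phi r (a : A)). Qed.

Definition opp_alg : alg_str R A^c := AlgStr opp_mapC.
End OppositeAlgebra.

(* The right [A]-module [Hom_A(P, A)], with [(u b) x = u x * b]. *)
Section Dual.
Variables (A : pzRingType) (P : lmodType A).

Definition dual : Type := {linear P -> A^o}.
HB.instance Definition _ := GRing.Zmodule.on dual.

Section Scale.
Variables (b : A^c) (u : dual).
Definition dual_scale_fun (x : P) : A^o := (u : {linear P -> A^o}) x * (b : A).
Fact dual_scale_linear : linear dual_scale_fun.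
Proof. by move=> a x y; rewrite /dual_scale_fun linearP mulrDl -mulrA. Qed.
HB.instance Definition _ := GRing.isLinear.Build A P A^o *:%R dual_scale_fun
  dual_scale_linear.
Definition dual_scale : dual := dual_scale_fun : {linear P -> A^o}.
End Scale.

Fact dual_scaleA b c u : dual_scale b (dual_scale c u) = dual_scale (b * c) u.
Proof. by apply: linear_ext => x; rewrite /= /dual_scale_fun /= mulrA. Qed.
Fact dual_scale1 : left_id 1 dual_scale.
Proof. by move=> u; apply: linear_ext => x; rewrite /= /dual_scale_fun mulr1. Qed.
Fact dual_scaleDr : right_distributive dual_scale +%R.
Proof. by move=> b u v; apply: linear_ext => x; rewrite /= /dual_scale_fun mulrDl. Qed.
Fact dual_scaleDl u : {morph dual_scale^~ u : b c / b + c}.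
Proof. by move=> b c; apply: linear_ext => x; rewrite /= /dual_scale_fun mulrDr. Qed.
HB.instance Definition _ := GRing.Zmodule_isLmodule.Build A^c dual
  dual_scaleA dual_scale1 dual_scaleDr dual_scaleDl.
End Dual.

Section Transpose.
Variables (A : pzRingType) (P Q : lmodType A) (f : {linear P -> Q}).
Definition transpose_fun (u : dual Q) : dual P :=
  ((u : {linear Q -> A^o}) \o f : P -> A^o) : {linear P -> A^o}.
Fact transpose_linear : linear transpose_fun.
Proof. by move=> b u v; apply: linear_ext. Qed.
HB.instance Definition _ := GRing.isLinear.Build A^c (dual Q) (dual P) *:%R
  transpose_fun transpose_linear.
Definition transpose : {linear dual Q -> dual P} := transpose_fun.
End Transpose.

(* The left [A]-module [Hom_R(C, J)] for a right [A]-module [C],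
   with [(a h) c = h (c a)]. *)
Section JDual.
Variables (R : comPzRingType) (A : pzRingType) (phi : alg_str R A).
Variables (J : lmodType R) (C : lmodType A^c).

Definition jdual : Type := {linear restr (opp_alg phi) C -> J}.
HB.instance Definition _ := GRing.Zmodule.on jdual.

Section Scale.
Variables (a : A) (h : jdual).
Definition jdual_scale_fun (c : restr (opp_alg phi) C) : J :=
  (h : {linear restr (opp_alg phi) C -> J}) ((a : A^c) *: (c : C)).
Fact jdual_scale_linear : linear jdual_scale_fun.
Proof.
move=> r x y; rewrite /jdual_scale_fun -linearP; congr (_ _).
rewrite scalerDr; congr (_ + _).
rewrite -[r *: x]/(opp_alg phi r *: (x : C)) -[RHS]/(opp_alg phi r *: ((a : A^c) *: (x : C))).
by rewrite !scalerA alg_mapC.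
Qed.
HB.instance Definition _ :=
  GRing.isLinear.Build R (restr (opp_alg phi) C) J *:%R jdual_scale_fun
    jdual_scale_linear.
Definition jdual_scale : jdual :=
  jdual_scale_fun : {linear restr (opp_alg phi) C -> J}.
End Scale.

Fact jdual_scaleA a b h : jdual_scale a (jdual_scale b h) = jdual_scale (a * b) h.
Proof. by apply: linear_ext => c; rewrite /= /jdual_scale_fun /= /jdual_scale_fun scalerA. Qed.
Fact jdual_scale1 : left_id 1 jdual_scale.
Proof. by move=> h; apply: linear_ext => c; rewrite /= /jdual_scale_fun scale1r. Qed.
Fact jdual_scaleDr : right_distributive jdual_scale +%R.
Proof. by move=> a h k; apply: linear_ext. Qed.
Fact jdual_scaleDl h : {morph jdual_scale^~ h : a b / a + b}.
Proof.
move=> a b; apply: linear_ext => c; rewrite /= /jdual_scale_fun scalerDl.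
exact: linearD.
Qed.
HB.instance Definition _ := GRing.Zmodule_isLmodule.Build A jdual
  jdual_scaleA jdual_scale1 jdual_scaleDr jdual_scaleDl.
End JDual.

Section AuslanderReiten.
Variables (R : comPzRingType) (A : pzRingType) (phi : alg_str R A).
Variable J : lmodType R.
Implicit Types N : lmodType A.

Definition minimal_presentation (P1 P0 N : lmodType A)
    (f : {linear P1 -> P0}) (g : {linear P0 -> N}) : Prop :=
  [/\ fg P1 /\ projective P1, fg P0 /\ projective P0,
      exact_at f g /\ (forall y, exists x, g x = y),
      right_minimal f & right_minimal g].

Definition Tr (P1 P0 : lmodType A) (f : {linear P1 -> P0}) : lmodType A^c :=
  coker (transpose f).

(* [tau N = D Tr N], where [f] is the first map of a minimal projective
   presentation of [N] and [D = Hom_R(-, J)]. *)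
Definition tau (P1 P0 : lmodType A) (f : {linear P1 -> P0}) : lmodType A :=
  jdual phi J (Tr f).

(* Minimal presentations of [N] exist and are unique up to isomorphism, so the
   choice of the presentation used to compute [tau N] is immaterial. *)
Definition tau_rigid N : Prop :=
  fg N /\
  forall (P1 P0 : lmodType A) (f : {linear P1 -> P0}) (g : {linear P0 -> N}),
    minimal_presentation f g -> forall h : {linear N -> tau f}, forall x, h x = 0.
End AuslanderReiten.

Section EndomorphismRing.
Variables (A : pzRingType) (X : lmodType A).

Definition end_one : {linear X -> X} := idfun.
Definition end_mul (f g : {linear X -> X}) : {linear X -> X} := f \o g.

Fact end_mulA : associative end_mul.
Proof. by move=> f g h; apply: linear_ext. Qed.
Fact end_mul1l : left_id end_one end_mul.
Proof. by move=> f; apply: linear_ext. Qed.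
Fact end_mul1r : right_id end_one end_mul.
Proof. by move=> f; apply: linear_ext. Qed.
Fact end_mulDl : left_distributive end_mul +%R.
Proof. by move=> f g h; apply: linear_ext. Qed.
Fact end_mulDr : right_distributive end_mul +%R.
Proof. by move=> f g h; apply: linear_ext => x; rewrite /= linearD. Qed.
HB.instance Definition _ := GRing.Zmodule_isPzRing.Build {linear X -> X}
  end_mulA end_mul1l end_mul1r end_mulDl end_mulDr.

(* [End_A(X)^op] *)
Definition endop : pzRingType := {linear X -> X}^c.

(* The left [endop X]-module [Hom_A(X, M)], acted on by precomposition. *)
Section HomModule.
Variable M : lmodType A.
Definition homX : Type := {linear X -> M}.
HB.instance Definition _ := GRing.Zmodule.on homX.

Definition homX_scale (t : endop) (u : homX) : homX :=
  ((u : {linear X -> M}) \o (t : {linear X -> X}) : X -> M) : {linear X -> M}.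

Fact homX_scaleA s t u : homX_scale s (homX_scale t u) = homX_scale (s * t) u.
Proof. by apply: linear_ext. Qed.
Fact homX_scale1 : left_id 1 homX_scale.
Proof. by move=> u; apply: linear_ext. Qed.
Fact homX_scaleDr : right_distributive homX_scale +%R.
Proof. by move=> t u v; apply: linear_ext. Qed.
Fact homX_scaleDl u : {morph homX_scale^~ u : s t / s + t}.
Proof. by move=> s t; apply: linear_ext => x; rewrite /= linearD. Qed.
HB.instance Definition _ := GRing.Zmodule_isLmodule.Build endop homX
  homX_scaleA homX_scale1 homX_scaleDr homX_scaleDl.
End HomModule.
End EndomorphismRing.

Section EndomorphismAlgebra.
Variables (R : comPzRingType) (A : pzRingType) (phi : alg_str R A) (X : lmodType A).

Section Homothety.
Variable r : R.
Definition homothety_fun (x : X) : X := phi r *: x.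
Fact homothety_linear : linear homothety_fun.
Proof.
by move=> a x y; rewrite /homothety_fun scalerDr !scalerA alg_mapC.
Qed.
HB.instance Definition _ := GRing.isLinear.Build A X X *:%R homothety_fun
  homothety_linear.
Definition homothety : {linear X -> X} := homothety_fun.
End Homothety.

Definition endop_map (r : R) : endop X := homothety r.

Fact endop_map_zmod : zmod_morphism endop_map.
Proof.
by move=> r s; apply: linear_ext => x; rewrite /= /homothety_fun rmorphB scalerBl.
Qed.
Fact endop_map_monoid : monoid_morphism endop_map.
Proof.
split=> [|r s]; apply: linear_ext => x; rewrite /= /homothety_fun.
  by rewrite rmorph1 scale1r.
by rewrite mulrC rmorphM -scalerA.
Qed.
HB.instance Definition _ :=
  GRing.isZmodMorphism.Build R (endop X) endop_map endop_map_zmod.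
HB.instance Definition _ :=
  GRing.isMonoidMorphism.Build R (endop X) endop_map endop_map_monoid.

Fact endop_mapC (r : R) (t : endop X) : endop_map r * t = t * endop_map r.
Proof.
by apply: linear_ext => x; rewrite /= /homothety_fun linearZ.
Qed.

Definition endop_alg : alg_str R (endop X) := AlgStr endop_mapC.
End EndomorphismAlgebra.

Section RelativeHomology.
Variables (A : pzRingType) (X : lmodType A).
Implicit Types M N P Z : lmodType A.

(* [0 -> Hom(Z, U) -> Hom(Z, V) -> Hom(Z, W) -> 0] is exact. *)
Definition Hom_exact Z (U V W : lmodType A)
    (f : {linear U -> V}) (g : {linear V -> W}) : Prop :=
  [/\ forall u u' : {linear Z -> U},
        (forall z, f (u z) = f (u' z)) -> forall z, u z = u' z,
      forall v : {linear Z -> V},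
        (forall z, g (v z) = 0) <->
        exists u : {linear Z -> U}, forall z, f (u z) = v z &
      forall w : {linear Z -> W},
        exists v : {linear Z -> V}, forall z, g (v z) = w z].

Definition F_exact (U V W : lmodType A)
    (f : {linear U -> V}) (g : {linear V -> W}) : Prop :=
  [/\ [/\ fg U, fg V & fg W], short_exact f g &
      forall Z, in_add X Z -> Hom_exact Z f g].

Definition F_projective P : Prop :=
  fg P /\
  forall (U V W : lmodType A) (f : {linear U -> V}) (g : {linear V -> W}),
    F_exact f g -> Hom_exact P f g.

Definition in_genF M Z : Prop :=
  exists (n : nat) (K : lmodType A) (f : {linear K -> copies M n})
         (g : {linear copies M n -> Z}), F_exact f g.

(* An F-projective resolution of [M], split into its short exact sequences
   [0 -> syz 0 -> term 0 -> M -> 0] and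
   [0 -> syz n.+1 -> term n.+1 -> syz n -> 0].
   [term n] is [P^{-n}], [aug] is [pi^0], and [bd n] is [pi^{-(n+1)}]. *)
Record F_resolution M := FResolution {
  term : nat -> lmodType A;
  syz : nat -> lmodType A;
  syz_in : forall n, {linear syz n -> term n};
  aug : {linear term 0 -> M};
  syz_cover : forall n, {linear term n.+1 -> syz n};
  term_proj : forall n, F_projective (term n);
  aug_exact : F_exact (syz_in 0) aug;
  syz_exact : forall n, F_exact (syz_in n.+1) (syz_cover n)
}.

Definition bd M (P : F_resolution M) (n : nat) : {linear term P n.+1 -> term P n} :=
  syz_in P n \o syz_cover P n.

(* [syz_cover P n] is [bd P n] corestricted to its image. *)
Definition minimal_resolution M (P : F_resolution M) : Prop :=
  right_minimal (aug P) /\ forall n, right_minimal (syz_cover P n).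

Definition cocycle M N (P : F_resolution M) (n : nat)
    (u : {linear term P n -> N}) : Prop :=
  forall x, u (bd P n x) = 0.

Definition coboundary M N (P : F_resolution M) (n : nat) :
    {linear term P n -> N} -> Prop :=
  match n with
  | 0 => fun u => forall x, u x = 0
  | m.+1 => fun u =>
      exists v : {linear term P m -> N}, forall x, u x = v (bd P m x)
  end.

(* [Ext^n_F(M, N) = 0]; the cohomology does not depend on the resolution. *)
Definition ExtF_eq0 (n : nat) M N : Prop :=
  forall (P : F_resolution M) (u : {linear term P n -> N}),
    cocycle u -> coboundary u.

End RelativeHomology.

(* [Hom_A(f, N)] is the zero map. *)
Definition Hom_map_eq0 (A : pzRingType) (U V N : lmodType A)
    (f : {linear U -> V}) : Prop :=
  forall (u : {linear V -> N}) x, u (f x) = 0.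

Section Complexes.
Variable A : pzRingType.

(* Cochain complexes.  The differential is a family indexed by all pairs of
   degrees which vanishes unless the second is the successor of the first; this
   avoids transports along equalities of degrees. *)
Record cochain := Cochain {
  obj :> int -> lmodType A;
  diff : forall i j, {linear obj i -> obj j};
  diff_shape : forall i j, j != i + 1 -> forall x, diff i j x = 0;
  diff2 : forall i j k x, diff j k (diff i j x) = 0
}.

Section Shift.
Variables (C : cochain) (k : int).
Definition shift_obj (i : int) : lmodType A := C (i + k).
Definition shift_diff i j : {linear shift_obj i -> shift_obj j} :=
  diff C (i + k) (j + k) *~ (-1) ^+ `|k|%N.

Fact shift_diffE i j x :
  shift_diff i j x = diff C (i + k) (j + k) x *~ (-1) ^+ `|k|%N.
Proof.
rewrite /shift_diff -signr_odd; case: (odd _) => /=.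
  by rewrite expr1 !mulrN1z.
by rewrite expr0 !mulr1z.
Qed.
Fact shift_diff_shape i j : j != i + 1 -> forall x, shift_diff i j x = 0.
Proof.
move=> ij x; rewrite shift_diffE diff_shape ?mul0rz //.
by rewrite addrAC (inj_eq (addIr k)).
Qed.
Fact shift_diff2 i j l x : shift_diff j l (shift_diff i j x) = 0.
Proof. by rewrite !shift_diffE raddfMz /= diff2 !mul0rz. Qed.
Definition shift : cochain := Cochain shift_diff_shape shift_diff2.
End Shift.

Record chain_map (C D : cochain) := ChainMap {
  cmap :> forall i, {linear C i -> D i};
  cmap_comm : forall i j x, cmap j (diff C i j x) = diff D i j (cmap i x)
}.

Definition null_homotopic (C D : cochain) (f : chain_map C D) : Prop :=
  exists h : forall i j, {linear C i -> D j},
    forall i x, f i x = diff D (i - 1) i (h i (i - 1) x)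
                        + h (i + 1) i (diff C i (i + 1) x).

Definition HomK_eq0 (C D : cochain) : Prop :=
  forall f : chain_map C D, null_homotopic f.

Definition in_Kb_add (X : lmodType A) (C : cochain) : Prop :=
  (forall i, in_add X (C i)) /\
  exists n : nat, forall i : int, (n < `|i|)%N -> forall x : C i, x = 0.

Definition presilting (X : lmodType A) (C : cochain) : Prop :=
  in_Kb_add X C /\ forall i : int, (0 < i)%R -> HomK_eq0 C (shift C i).

(* [P1 -> P0] in degrees -1 and 0; [Negz 0] is -1. *)
Section TwoTerm.
Variables (P1 P0 : lmodType A) (f : {linear P1 -> P0}).

Definition two_obj (i : int) : lmodType A :=
  match i with
  | Posz 0 => P0
  | Negz 0 => P1
  | _ => copies P0 0
  end.

Definition two_diff (i j : int) : {linear two_obj i -> two_obj j} :=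
  match i as i', j as j' return {linear two_obj i' -> two_obj j'} with
  | Negz 0, Posz 0 => f
  | _, _ => \0
  end.

Fact two_diff_shape i j : j != i + 1 -> forall x, two_diff i j x = 0.
Proof. by case: i j => [[|?]|[|?]] [[|?]|[|?]]. Qed.
Fact two_diff2 i j k x : two_diff j k (two_diff i j x) = 0.
Proof.
by case: i j k x => [[|?]|[|?]] [[|?]|[|?]] [[|?]|[|?]] //= x; rewrite ?linear0.
Qed.
Definition two_term : cochain := Cochain two_diff_shape two_diff2.
End TwoTerm.

(* [P] is the minimal F-projective resolution of [M]. *)
Definition F_presilting (X M : lmodType A) (P : F_resolution X M) : Prop :=
  presilting X (two_term (bd P 0)).

End Complexes.

(* Main.v *)
From HB Require Import structures.
From mathcomp Require Import all_boot all_order all_algebra.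
From mathcomp Require Import boolp classical_sets.
From mathcomp Require Import zify.
Require Import Defs.

Set Implicit Arguments.
Unset Strict Implicit.
Unset Printing Implicit Defensive.

Import GRing.Theory.
Local Open Scope ring_scope.

(** Write [d : P1 -> P0] for the first differential of the resolution.  All
    four conditions are equivalent to the surjectivity of
    [Hom(d, M) : Hom(P0, M) -> Hom(P1, M)], here [factors_through (bd P 0) M].

    The only possibly nonzero component of a map from the two-term complex to
    a positive shift of it is a map [h : P1 -> P0] in degree one, and it is
    null-homotopic exactly if [h = d s + t d].  Composing with the augmentation turns
    this into the factorization of a map [P1 -> M] through [d]
    ([presilting_factors_through]).  For this (a) also needs [P0] and [P1] to
    lie in [add X]: an F-projective module [Q] has a right approximation
    [X^n -> Q] whose kernel sequence is F-exact, hence split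
    ([F_projective_in_add]).  The approximation and the finite generation of
    its kernel rest on the theorem that a commutative artinian ring is
    noetherian ([artinian_noetherian]).

    A map [P1 -> M] factors through the first syzygy exactly if it is killed by
    the second differential, and then [Ext^1_F(M, M) = 0] extends it to [P0];
    this is (b).  For (c), a map from the syzygy to [Z] in [gen_F(M)] lifts on
    [P1] to a finite power of [M], where it factors through [d]; conversely [M] itself is in [gen_F(M)].

    The functor [Hom(X, -)] is fully faithful on [add X] and turns [d] into a
    minimal projective presentation of [Hom(X, M)] over [End(X)^op].  For a
    minimal projective presentation [f : Q1 -> Q0] of [N] the pairing
    [Hom(Q1, A) (x) N = Hom(Q1, N)] identifies [Hom(N, tau N)] with the
    [J]-dual of the cokernel of [Hom(f, N)] ([factors_through_hom_tau0],
    [hom_tau0_factors_through]); since [J] is a cogenerator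
    ([nonzero_functional]), the first vanishes exactly if [Hom(f, N)] is onto.
    That this does not depend on the minimal presentation is
    [minimal_presentation_factors_through]. *)

(** * Linear maps, submodules and quotients *)

Section LinearMap.
Variables (A : pzRingType) (U V : lmodType A) (f : U -> V) (lin_f : linear f).
HB.instance Definition _ := GRing.isLinear.Build A U V *:%R f lin_f.
Definition linear_map : {linear U -> V} := f.
End LinearMap.

Lemma lin_sumE (A : pzRingType) (U V : lmodType A) (I : Type) (r : seq I)
    (P : pred I) (F : I -> {linear U -> V}) (x : U) :
  (\sum_(i <- r | P i) F i) x = \sum_(i <- r | P i) F i x.
Proof.
by elim/big_rec2: _ => //= i y f _ <-.
Qed.

Lemma im_inverse (A : pzRingType) (T U V : lmodType A) (f : {linear U -> V})
    (g : {linear T -> V}) :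
  injective f -> (forall x, exists y, f y = g x) ->
  exists h : {linear T -> U}, forall x, f (h x) = g x.
Proof.
move=> f_inj /choice[h fh].
have lin_h : linear h.
  by move=> a x y; apply: f_inj; rewrite linearP !fh linearP.
by exists (linear_map lin_h).
Qed.

Section Submodule.
Variables (A : pzRingType) (V : lmodType A) (S : V -> Prop).
Hypothesis subS : submodule S.

Lemma submodule0 : S 0. Proof. by case: subS. Qed.
Lemma submoduleD x y : S x -> S y -> S (x + y).
Proof. by move=> Sx Sy; case: subS => _ /(_ 1 x y Sx Sy); rewrite scale1r. Qed.
Lemma submoduleZ a x : S x -> S (a *: x).
Proof. by move=> Sx; case: subS => S0 /(_ a x 0 Sx S0); rewrite addr0. Qed.
Lemma submoduleB x y : S x -> S y -> S (x - y).
Proof.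
by move=> Sx Sy; rewrite -scaleN1r; apply/submoduleD/submoduleZ.
Qed.
End Submodule.

Section KernelModule.
Variables (A : pzRingType) (U V : lmodType A) (f : {linear U -> V}).

Definition ker_pred : {pred U} := fun u => f u == 0.
Fact ker_submod_closed : submod_closed ker_pred.
Proof.
split=> [|a x y]; rewrite !unfold_in ?linear0 // => /eqP fx /eqP fy.
by rewrite linearP fx fy scaler0 addr0.
Qed.
HB.instance Definition _ :=
  GRing.isSubmodClosed.Build A U ker_pred ker_submod_closed.

Record ker_mod := KerMod { ker_val :> U; _ : ker_val \in ker_pred }.
HB.instance Definition _ := [isSub for ker_val].
HB.instance Definition _ := [Choice of ker_mod by <:].
HB.instance Definition _ := [SubChoice_isSubLmodule of ker_mod by <:].

Definition ker_in : {linear ker_mod -> U} := val.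

Lemma ker_in_inj : injective ker_in. Proof. exact: val_inj. Qed.

Lemma ker_in_exact : exact_at ker_in f.
Proof.
move=> y; split=> [fy|[x <-]].
  have ker_y : y \in ker_pred by rewrite unfold_in fy.
  by exists (KerMod ker_y).
exact/eqP/(valP x).
Qed.
End KernelModule.

Section QuotientMap.
Variables (A : pzRingType) (V : lmodType A) (S : V -> Prop).
Hypothesis subS : submodule S.
Local Open Scope quotient_scope.

Definition quot_proj_fun (v : V) : quotmod subS :=
  \pi_(Quotient.quot (subm_pred S)) v.
Fact quot_proj_linear : linear quot_proj_fun.
Proof. by move=> a x y; rewrite /quot_proj_fun -pi_addE -quot_scale_pi. Qed.
Definition quot_proj := linear_map quot_proj_linear.

Lemma quot_proj_surj (x : quotmod subS) : exists v, x = quot_proj v.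
Proof. exact: quot_surj. Qed.

Lemma quot_proj_eq0 v : quot_proj v = 0 <-> S v.
Proof.
rewrite -[0](linear0 quot_proj).
have -> : (quot_proj v = quot_proj 0) <-> `[< S (v - 0) >].
  by split=> [/eqP|Sv]; [|apply/eqP]; rewrite -[_ == _]Quotient.idealrBE.
by rewrite subr0; split=> /asboolP.
Qed.

(** Stated for maps of abelian groups, so that it applies to semilinear
    situations such as a quotient over one ring mapped linearly over another. *)
Lemma quot_lift (W : zmodType) (g : V -> W) :
  (forall x y, g (x - y) = g x - g y) -> (forall x, S x -> g x = 0) ->
  exists h : quotmod subS -> W, forall v, h (quot_proj v) = g v.
Proof.
move=> gB gS; exists (fun x => g (repr x)) => v.
apply/eqP; rewrite -subr_eq0 -gB; apply/eqP/gS.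
apply/quot_proj_eq0; rewrite linearB /=; apply/eqP; rewrite subr_eq0; apply/eqP.
by rewrite /quot_proj_fun reprK.
Qed.
End QuotientMap.

(** * Finitely generated submodules *)

Section Span.
Variables (A : pzRingType) (V : lmodType A).
Implicit Types (s t : seq V) (S T : V -> Prop).

(** The recursion peels off one generator, which is the shape in which spans
    are used in the inductions below. *)
Fixpoint span s (x : V) : Prop :=
  if s is a :: s' then exists r, span s' (x - r *: a) else x = 0.

Definition fg_sub S : Prop := exists s, forall x, S x <-> span s x.

Lemma span_submodule s : submodule (span s).
Proof.
elim: s => [|a s [IH0 IHP]]; first by split=> //= r x y -> ->; rewrite scaler0 addr0.
split=> [|r x y [p sx] [q sy]]; first by exists 0; rewrite scale0r subr0.
exists (r * p + q); rewrite scalerDl opprD addrACA -scalerA -scalerBr.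
exact: IHP.
Qed.

Lemma span_cons a s x : span s x -> span (a :: s) x.
Proof. by move=> sx; exists 0; rewrite scale0r subr0. Qed.

Lemma span_mem s x : x \in s -> span s x.
Proof.
elim: s => //= a s IHs; rewrite inE => /predU1P[->|/IHs sx].
  by exists 1; rewrite scale1r subrr; apply: submodule0 (span_submodule _).
exact: span_cons.
Qed.

Lemma span_sub S s x :
  submodule S -> (forall y, y \in s -> S y) -> span s x -> S x.
Proof.
move=> subS; elim: s x => [x _ ->|a s IHs x Ss [r sx]]; first exact: submodule0.
rewrite -(subrK (r *: a) x); apply: submoduleD => //.
  by apply: IHs => // y ys; apply: Ss; rewrite inE ys orbT.
by apply: submoduleZ => //; apply: Ss; rewrite mem_head.
Qed.

Lemma span_cat s t x : (exists2 y, span s y & span t (x - y)) -> span (s ++ t) x.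
Proof.
elim: s x => [|a s IHs] x /= [y]; first by move=> ->; rewrite subr0.
case=> r sy ty; exists r; apply: IHs; exists (y - r *: a) => //.
by rewrite opprB addrA subrK.
Qed.

Lemma fg_sub_ext S T : (forall x, S x <-> T x) -> fg_sub S -> fg_sub T.
Proof. by move=> ST [s Ss]; exists s => x; rewrite -ST. Qed.

Lemma span_sum I (r : seq I) (c : I -> A) (e : I -> V) :
  span [seq e i | i <- r] (\sum_(i <- r) c i *: e i).
Proof.
elim: r => [|i r IHr] /=; first by rewrite big_nil.
by exists (c i); rewrite big_cons addrC addKr.
Qed.

Lemma span_combination s x :
  span s x -> exists c : 'I_(size s) -> A, x = \sum_i c i *: tnth (in_tuple s) i.
Proof.
elim: s x => [|a s IHs] x /=; first by move=> ->; exists (fun=> 0); rewrite big_ord0.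
case=> r /IHs[c xE].
exists (fun i => if unlift ord0 i is Some j then c j else r).
rewrite big_ord_recl unlift_none (tnth_nth 0) /= -[LHS](subrK (r *: a)) addrC xE.
congr (_ + _); apply: eq_bigr => j _; rewrite liftK.
by rewrite !(tnth_nth 0).
Qed.

Lemma fg_span : fg V <-> exists s, forall x, span s x.
Proof.
split=> [[n [e Ve]]|[s Vs]].
  exists [seq e i | i <- enum 'I_n] => x; have [c ->] := Ve x.
  by rewrite -big_enum; apply: span_sum.
by exists (size s), (tnth (in_tuple s)) => x; apply: span_combination.
Qed.

Lemma fg_fin (I : finType) (e : I -> V) :
  (forall x, exists c : I -> A, x = \sum_i c i *: e i) -> fg V.
Proof.
move=> Ve; apply/fg_span; exists [seq e i | i <- enum I] => x.
by have [c ->] := Ve x; rewrite -big_enum; apply: span_sum.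
Qed.
End Span.

(** Lifts of generators of the image together with generators of the kernel
    generate [S].  The map onto the quotient is replaced by a linear relation [rho], so that the
    coefficient of a chosen generator, which is not a function on the module,
    can be used as well. *)
Lemma fg_sub_extension (A : pzRingType) (V W : lmodType A) (S : V -> Prop)
    (rho : V -> W -> Prop) :
    submodule S ->
    rho 0 0 ->
    (forall a x y v w, rho x v -> rho y w -> rho (a *: x + y) (a *: v + w)) ->
    (forall x, S x -> exists w, rho x w) ->
    fg_sub (fun w => exists2 x, S x & rho x w) ->
    fg_sub (fun x => S x /\ rho x 0) ->
  fg_sub S.
Proof.
move=> subS rho0 rhoP rho_dom [ws wsP] [s0 s0P].
have [xs [Sxs xsP]] : exists xs, (forall x, x \in xs -> S x) /\
    forall w, span ws w -> exists2 x, span xs x & rho x w.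
  have : forall w, w \in ws -> exists2 x, S x & rho x w.
    by move=> w /span_mem /wsP.
  elim: ws {wsP} => [_|w0 ws IH Sws].
    by exists [::]; split=> // w ->; exists 0.
  have [w w_ws|xs [Sxs xsP]] := IH.
    by apply: Sws; rewrite inE w_ws orbT.
  have [x0 Sx0 rho_x0] := Sws w0 (mem_head _ _).
  exists (x0 :: xs); split=> [x|w /= [r /xsP[x sx rho_x]]].
    by rewrite inE => /predU1P[->|/Sxs].
  exists (r *: x0 + x); first by exists r; rewrite addrC addKr.
  by have := rhoP r _ _ _ _ rho_x0 rho_x; rewrite [r *: w0 + _]addrC subrK.
exists (xs ++ s0) => x; split=> [Sx|]; last first.
  apply: span_sub => // y; rewrite mem_cat => /orP[/Sxs //|].
  by move/span_mem/s0P => [].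
have [w rho_x] := rho_dom x Sx.
have [|y sy rho_y] := xsP w; first by apply/wsP; exists x.
apply: span_cat; exists y => //; apply/s0P; split.
  by apply: submoduleB => //; apply: span_sub sy.
by have := rhoP (-1) _ _ _ _ rho_y rho_x; rewrite !scaleN1r addrC addNr.
Qed.

Definition noetherian (A : pzRingType) (V : lmodType A) : Prop :=
  forall S : V -> Prop, submodule S -> fg_sub S.

(** Induction on the number of generators: the coefficients that a generator
    [a] can have in elements of [S] form a left ideal. *)
Lemma noetherian_fg (A : pzRingType) (V : lmodType A) :
  noetherian (A^o : lmodType A) -> fg V -> noetherian V.
Proof.
move=> noethA /fg_span[s Vs] S subS.
suffices fgS : forall S, submodule S -> (forall x, S x -> span s x) -> fg_sub S.
  exact: fgS.
elim: s {S subS Vs} => [|a s IHs] S subS Ss.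
  by exists [::] => x; split=> [/Ss|->] //; apply: submodule0.
pose rho (x : V) (r : A^o) := span s (x - (r : A) *: a).
have rhoP b x y v w : rho x v -> rho y w -> rho (b *: x + y) (b *: v + w).
  move=> sx sy; rewrite /rho.
  have -> : b *: x + y - ((b *: v + w : A^o) : A) *: a
      = b *: (x - (v : A) *: a) + (y - (w : A) *: a).
    by rewrite scalerDl -scalerA scalerBr opprD addrACA.
  by case: (span_submodule s) => _; apply.
have rho0 : rho 0 0.
  by rewrite /rho scale0r subr0; apply: submodule0 (span_submodule s).
apply: (fg_sub_extension subS rho0 rhoP); [exact: Ss|..].
  apply: noethA; split; first by exists 0; rewrite //; apply: submodule0.
  move=> b v w [x Sx rx] [y Sy ry]; exists (b *: x + y); last exact: rhoP.
  by case: subS => _; apply.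
apply: IHs => [|x [_]]; last by rewrite /rho scale0r subr0.
split; first by split=> //; apply: submodule0.
move=> b x y [Sx rx] [Sy ry]; split; first by case: subS => _; apply.
by have := rhoP b _ _ _ _ rx ry; rewrite scaler0 addr0.
Qed.

Lemma fg_copies (A : pzRingType) (V : lmodType A) n : fg V -> fg (copies V n).
Proof.
move=> [m [e Ve]].
pose b (p : 'I_n * 'I_m) : copies V n := [ffun k => if k == p.1 then e p.2 else 0].
apply: (fg_fin (e := b)) => x.
have /choice[c xE] : forall i, exists c : 'I_m -> A, x i = \sum_j c j *: e j.
  by move=> i; apply: Ve.
exists (fun p => c p.1 p.2); apply/ffunP => k.
rewrite sum_ffunE xE -(pair_bigA _ (fun i j => (c i j *: b (i, j)) k)) /=.
rewrite (bigD1 k) //= [X in _ + X]big1 ?addr0 => [|i ik].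
  by apply: eq_bigr => j _; rewrite !ffunE eqxx.
by rewrite big1 // => j _; rewrite !ffunE eq_sym (negPf ik) scaler0.
Qed.

Lemma fg_image (A : pzRingType) (U V : lmodType A) (f : {linear U -> V}) :
  (forall v, exists u, f u = v) -> fg U -> fg V.
Proof.
move=> f_surj [n [e Ue]]; exists n, (fun i => f (e i)) => v.
have [u <-] := f_surj v; have [c ->] := Ue u; exists c.
by rewrite linear_sum; apply: eq_bigr => i _; rewrite linearZ.
Qed.

(** * Commutative artinian rings *)

Section ArtinianRing.
Variables (R : comPzRingType) (artR : artinian R).
Implicit Types (I K T : R -> Prop) (P : (R -> Prop) -> Prop).

Lemma artinian_min P :
  (exists2 I, ideal I & P I) ->
  exists I, [/\ ideal I, P I &
    forall K, ideal K -> P K -> (forall r, K r -> I r) -> forall r, I r -> K r].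
Proof.
move=> [I0 idI0 PI0]; apply: contrapT => noI.
pose Q := {I | ideal I /\ P I}.
have /choice[nxt nxtP] : forall I : Q, exists K : Q,
    (forall r, sval K r -> sval I r) /\ (exists2 r, sval I r & ~ sval K r).
  move=> [I [idI PI]]; apply: contrapT => noK; apply: noI; exists I; split=> //.
  move=> K idK PK KI r Ir; apply: contrapT => nKr; apply: noK.
  by exists (exist _ K (conj idK PK)); split=> //; exists r.
pose chain n : Q := iter n nxt (exist _ I0 (conj idI0 PI0)).
have [||n nP] := artR (I := fun n => sval (chain n)).
- by move=> n; case: (svalP (chain n)).
- by move=> n r; apply: (nxtP (chain n)).1.
have [_ [r Ir]] := nxtP (chain n); apply.
exact: (nP n.+1 (leqnSn n)).
Qed.

Lemma idealM I r x : ideal I -> I x -> I (r * x).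
Proof. by move=> idI Ix; apply: (submoduleZ (idI : submodule (I : R^o -> Prop)) r Ix). Qed.

Lemma idealD I x y : ideal I -> I x -> I y -> I (x + y).
Proof. by move=> idI; apply: (submoduleD (idI : submodule (I : R^o -> Prop))). Qed.

Lemma multiples_ideal I r : ideal I -> ideal (fun x => exists2 t, I t & x = r * t).
Proof.
move=> idI; split; first by exists 0; rewrite ?mulr0 //; apply: (proj1 idI).
move=> a _ _ [x Ix ->] [y Iy ->]; exists (a * x + y).
  by apply: idealD => //; apply: idealM.
by rewrite mulrDr mulrCA.
Qed.

Lemma annihilator_ideal T : ideal (fun r => forall t, T t -> r * t = 0).
Proof.
split=> [t _|a x y xT yT t Tt]; first by rewrite mul0r.
by rewrite mulrDl -mulrA xT // yT // mulr0 addr0.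
Qed.

(** Among the ideals not contained in the maximal ideal [I], a minimal one is
    generated by each of its elements outside [I]; multiplying such a
    generator [y] by an element of another maximal ideal outside [I] changes
    nothing, so [y] lies in all the other maximal ideals.  Thus the class of
    [y] spans a copy of the simple module [R / I] in [R / rad R]. *)
Lemma maximal_ideal_socle I :
  maximal_ideal I -> exists2 y : R, ~ rad y & forall r, I r -> rad (r * y).
Proof.
move=> maxI; have [idI I1 Imax] := maxI.
have primeI x y : ~ I x -> ~ I y -> ~ I (x * y).
  move=> nIx nIy Ixy; apply: nIx.
  pose K r := I (r * y).
  have idK : ideal K.
    split; first by rewrite /K mul0r; apply: (proj1 idI).
    move=> a u v Ku Kv; rewrite /K mulrDl -mulrA.
    by apply: idealD => //; apply: idealM.
  apply: (Imax K) => //; first by rewrite /K mul1r.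
  by move=> r Ir; rewrite /K mulrC; apply: idealM.
have [|S [idS [y Sy nIy] Smin]] := artinian_min (P := fun S => exists2 y, S y & ~ I y).
  by exists (fun=> True); [split|exists 1].
have Sgen z : S z -> ~ I z -> forall x, S x -> exists2 r, True & x = z * r.
  move=> Sz nIz; apply: (Smin (fun x => exists2 r, True & x = z * r)).
  - exact: (multiples_ideal (I := fun=> True)).
  - by exists z => //; exists 1; rewrite ?mulr1.
  - by move=> _ [r _ ->]; rewrite mulrC; apply: idealM.
have y_other K : maximal_ideal K -> (exists2 r, K r & ~ I r) -> K y.
  move=> [idK K1 Kmax] [r Kr nIr].
  have [||s _ ->] := Sgen (r * y) _ _ y Sy; [exact: idealM|exact: primeI|].
  by rewrite mulrC mulrCA mulrC; apply: idealM.
exists y => [rad_y|r Ir K maxK]; first exact: nIy (rad_y I maxI).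
have [KI|] := pselect (forall r, K r -> I r).
  have [idK K1 Kmax] := maxK.
  by rewrite mulrC; apply: idealM => //; apply: Kmax Ir.
move=> /existsNP[k /not_implyP[Kk nIk]].
have [idK _ _] := maxK.
by apply: idealM => //; apply: y_other => //; exists k.
Qed.

(** The nonzero submodules of the cyclic module of [w] correspond to the ideals
    strictly above the annihilator of [w]; a minimal such ideal gives a simple
    submodule, and its generator [a *: w] has a maximal annihilator. *)
Lemma maximal_annihilator (V : lmodType R) (w : V) :
  w <> 0 -> exists a : R, maximal_ideal (fun r => r *: (a *: w) = 0).
Proof.
move=> w0.
pose ann (r : R) := r *: w = 0.
have [|K [idK [annK [a Ka naw]] Kmin]] :=
    artinian_min (P := fun K => (forall r, ann r -> K r) /\ exists2 a, K a & ~ ann a).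
  exists (fun=> True); first by split.
  by split=> //; exists 1 => //; rewrite /ann scale1r.
exists a; split.
- split=> [|r x y rx ry]; first by rewrite scale0r.
  by rewrite scalerDl -[r *: x]/(r * x) -scalerA rx ry scaler0 addr0.
- by rewrite scale1r.
move=> m idm m1 ann_m r mr; apply: contrapT => nra.
pose K' x := exists s, ann (x - s * (r * a)).
have [|||s] := Kmin K' _ _ _ a Ka.
- split; first by exists 0; rewrite mul0r subr0 /ann scale0r.
  move=> b x y [s xs] [t yt]; exists (b * s + t).
  rewrite /ann -[b *: x]/(b * x) mulrDl opprD addrACA -mulrA -mulrBr.
  by rewrite scalerDl -scalerA xs yt scaler0 addr0.
- split=> [x ann_x|]; first by exists 0; rewrite mul0r subr0.
  exists (r * a); first by exists 1; rewrite mul1r subrr /ann scale0r.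
  by rewrite /ann -scalerA.
- move=> x [s ann_x]; rewrite -(subrK (s * (r * a)) x).
  by apply: idealD => //; [exact: annK|apply: idealM => //; apply: idealM].
rewrite /ann mulrA -{1}[a]mul1r -mulrBl -scalerA => /ann_m m1sr.
by apply: m1; rewrite -(subrK (s * r) 1); apply: idealD => //; apply: idealM.
Qed.

(** When [T] is a vector space over a residue field of [R], such a [T'] is a
    hyperplane of [T] complementing the line of [x]. *)
Lemma maximal_avoiding T (x : R) :
  ideal T -> x != 0 ->
  exists T', [/\ ideal T', (forall r, T' r -> T r), ~ T' x &
    forall K, ideal K -> (forall r, K r -> T r) -> (forall r, T' r -> K r) ->
      ~ K x -> forall r, K r -> T' r].
Proof.
move=> idT x0.
(* the empty set is allowed so that the empty chain has an upper bound *)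
pose P (K : set R) := K = set0 \/ [/\ ideal K, (forall r, K r -> T r) & ~ K x].
have [|T' [PT' T'max]] := @Zorn_bigcup R P.
  move=> F FP Ftot.
  have [F0|/existsNP[K0 /not_implyP[FK0 nK0]]] := pselect (forall K, F K -> K = set0).
    by left; rewrite -subset0 => r [K /F0 ->].
  have {nK0}[K00 _ _] : [/\ ideal K0, (forall r, K0 r -> T r) & ~ K0 x].
    by case: (FP K0 FK0).
  have FP' K r : F K -> K r -> [/\ ideal K, (forall r, K r -> T r) & ~ K x].
    by move=> FK Kr; case: (FP K FK) => [K_0|//]; rewrite K_0 in Kr.
  right; split=> [|r [K FK Kr]|[K FK Kx]].
  - split; first by exists K0 => //; case: K00.
    move=> a u v [K FK Ku] [K' FK' Kv].
    have [idK _ _] := FP' K u FK Ku; have [idK' _ _] := FP' K' v FK' Kv.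
    have [KK'|K'K] := Ftot K K' FK FK'.
      by exists K' => //; case: idK' => _; apply=> //; apply: KK'.
    by exists K => //; case: idK => _; apply=> //; apply: K'K.
  - by have [_ + _] := FP' K r FK Kr; apply.
  - by have [_ _] := FP' K x FK Kx; apply.
have zero_ideal : [/\ ideal (fun r => r = 0), (forall r, r = 0 -> T r) & x <> 0].
  split; last exact/eqP.
    by split=> // a u v -> ->; rewrite scaler0 addr0.
  by move=> r ->; case: idT.
case: PT' => [T'0|[idT' T'T nT'x]].
  case: (T'max (fun r => r = 0)); last by right.
  by rewrite T'0; split=> // /(_ 0 erefl).
exists T'; split=> // K idK KT T'K nKx r Kr; apply: contrapT => nT'r.
by case: (T'max K); [split=> // KT'; apply/nT'r/KT'|right].
Qed.
End ArtinianRing.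

(** An ideal [T] minimal among those that are not finitely generated satisfies
    [r T = T] or [r T = 0] for every [r], since both [r T] and the annihilator
    of [r] in [T] would otherwise be finitely generated.  Hence the
    annihilator of [T] is a prime of an artinian ring, so [T] is a vector
    space over a field; but a hyperplane of [T] is finitely generated by
    minimality, and then so is [T]. *)
Theorem artinian_noetherian (R : comPzRingType) :
  artinian R -> noetherian (R^o : lmodType R).
Proof.
move=> artR; apply: contrapT => /existsNP[S /not_implyP[idS nfgS]].
have [|T [idT nfgT Tmin]] :=
  artinian_min artR (P := fun I => ~ fg_sub (I : R^o -> Prop)); first by exists S.
have fg_proper K : ideal K -> (forall r, K r -> T r) -> (exists2 t, T t & ~ K t) ->
    fg_sub (K : R^o -> Prop).
  move=> idK KT [t Tt nKt]; apply: contrapT => nfgK.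
  exact/nKt/(Tmin K).
have T_mul r : (forall t, T t -> r * t = 0) \/
    (forall t, T t -> exists2 t', T t' & t = r * t').
  apply: contrapT => /not_orP[nT0 nTT]; apply: nfgT.
  apply: (fg_sub_extension (V := R^o) (W := R^o) (rho := fun x w => r * x = w)) => //.
  - by rewrite mulr0.
  - by move=> a x y v w <- <-; rewrite mulrDr mulrCA.
  - by move=> x _; exists (r * x).
  - apply: (@fg_sub_ext _ R^o (fun w => exists2 t, T t & w = r * t)).
      by move=> w; split=> [[t Tt ->]|[t Tt <-]]; exists t.
    apply: fg_proper; first exact: multiples_ideal.
      by move=> _ [t Tt ->]; apply: idealM.
    by move: nTT => /existsNP[t /not_implyP[Tt nt]]; exists t.
  - apply: fg_proper => [|x []//|].
      split; first by split; [case: idT|rewrite mulr0].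
      move=> a x y [Tx rx] [Ty ry]; split; first by case: idT => _; apply.
      by rewrite mulrDr mulrCA rx ry mulr0 addr0.
    move: nT0 => /existsNP[t /not_implyP[Tt nt]]; exists t => //.
    by case.
pose ann r := forall t, T t -> r * t = 0.
have idann : ideal ann by exact: annihilator_ideal.
have [x Tx x0] : exists2 x, T x & x != 0.
  apply: contrapT => noT; apply: nfgT; exists [::] => x /=; split=> [Tx|->].
    by apply: contrapT => /eqP x0; apply: noT; exists x.
  by case: idT.
have T_neq0 r : (forall t, T t -> exists2 t', T t' & t = r * t') -> ~ ann r.
  by move=> /(_ x Tx)[t Tt xE] /(_ t Tt); rewrite -xE; apply/eqP.
(* a minimal ideal outside [ann], containing [y] outside [ann], is generated
   by [r * y], so [r] is invertible modulo [ann] *)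
have T_inv r : ~ ann r -> exists s, ann (1 - s * r).
  have [|I [idI [y Iy nay] Imin]] :=
      artinian_min artR (P := fun I => exists2 y, I y & ~ ann y).
    exists (fun=> True); first by split.
    exists 1 => // /(_ x Tx); rewrite mul1r; exact/eqP.
  move=> nar; have rT : forall t, T t -> exists2 t', T t' & t = r * t'.
    by case: (T_mul r).
  have yT : forall t, T t -> exists2 t', T t' & t = y * t'.
    by case: (T_mul y).
  have nary : ~ ann (r * y).
    apply: T_neq0 => t /rT[t' /yT[t'' Tt'' ->] ->].
    by exists t''; rewrite ?mulrA.
  have [|||s _ yE] := Imin (fun z => exists2 s, True & z = (r * y) * s) _ _ _ y Iy.
  - exact: (multiples_ideal (I := fun=> True)).
  - by exists (r * y) => //; exists 1; rewrite ?mulr1.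
  - by move=> _ [s _ ->]; rewrite mulrC; apply: idealM => //; apply: idealM.
  exists s => t Tt; have [t' Tt' ->] := yT t Tt.
  by rewrite mulrA mulrBl mul1r {1}yE mulrC [_ * s]mulrC mulrA subrr mulr0.
(* split the line of [x] off the vector space [T] over the field [R / ann] *)
have [T' [idT' T'T nT'x T'max]] := maximal_avoiding idT x0.
have [|s sP] := fg_proper T' idT' T'T; first by exists x.
apply: nfgT; exists ((x : R^o) :: s) => t /=; split=> [Tt|[r /sP T't]]; last first.
  rewrite -(subrK (r *: (x : R^o)) t).
  by apply: idealD; rewrite // ; [exact: T'T|exact: idealM].
have [T't|nT't] := pselect (T' t).
  by exists 0; apply/sP; rewrite scale0r subr0.
pose K z := exists b, T' (z - b * t).
have Kx : K x.
  apply: contrapT => nKx; apply: nT't; apply: (T'max K) => //.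
  - split; first by exists 0; rewrite mul0r subr0; case: idT'.
    move=> a u v [b uT'] [c vT']; exists (a * b + c).
    rewrite mulrDl opprD addrACA -mulrA -mulrBr.
    by case: idT' => _; apply.
  - move=> z [b zT']; rewrite -(subrK (b * t) z).
    by apply: idealD => //; [exact: T'T|exact: idealM].
  - by move=> z T'z; exists 0; rewrite mul0r subr0.
  - by exists 1; rewrite mul1r subrr; case: idT'.
case: Kx => b xbt.
have [ab|nab] := pselect (ann b).
  by case: nT'x; move: xbt; rewrite ab // subr0.
have [c /(_ t Tt)] := T_inv b nab.
rewrite mulrBl mul1r => /eqP; rewrite subr_eq0 => /eqP tE.
exists c; apply/sP.
rewrite -[c *: _]/(c * x) {1}tE -mulrA -mulrBr -opprB mulrN -mulNr.
exact: idealM.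
Qed.

(** * Separating elements by functionals *)

Section Cogenerator.
Variables (R : comPzRingType) (artR : artinian R).
Variables (J : lmodType R) (iota : {linear Rtop R -> J}).
Hypotheses (iota_inj : injective iota) (injJ : injective_module J).

(** The cyclic module of [w] contains a simple one, generated by some [a *: w],
    and its annihilator kills a nonzero element of [R / rad R], hence of [J].
    Injectivity of [J] extends the resulting map from the simple module. *)
Lemma nonzero_functional (V : lmodType R) (w : V) :
  w <> 0 -> exists l : {linear V -> J}, l w <> 0.
Proof.
move=> w0; have [a maxI] := maximal_annihilator artR w0.
have [y nrad_y rad_y] := maximal_ideal_socle artR maxI.
have [idI I1 _] := maxI.
pose j := iota (quot_proj (rad_submodule R) y).
have j0 : j <> 0.
  rewrite /j -[0](linear0 iota) => /iota_inj.
  by rewrite -[0](linear0 (quot_proj _)) => /eqP; rewrite linear0 => /eqP/quot_proj_eq0.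
have Ij r : r *: (a *: w) = 0 -> r *: j = 0.
  move=> /rad_y /(quot_proj_eq0 (rad_submodule R)) rad_ry.
  by rewrite /j -!linearZ -[r *: (y : R^o)]/(r * y) rad_ry linear0.
have [|x /= ax0|f fE] := quot_lift idI (g := fun r : R^o => r *: (a *: w)).
- by move=> x y'; rewrite scalerBl.
- exact: ax0.
have [||h hE] := quot_lift idI (g := fun r : R^o => r *: j).
- by move=> x y'; rewrite scalerBl.
- exact: Ij.
have lin_f : linear f.
  move=> b u v; have [u' ->] := quot_proj_surj u; have [v' ->] := quot_proj_surj v.
  by rewrite -linearP !fE scalerDl; congr (_ + _); exact: esym (scalerA _ _ _).
have lin_h : linear h.
  move=> b u v; have [u' ->] := quot_proj_surj u; have [v' ->] := quot_proj_surj v.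
  by rewrite -linearP !hE scalerDl; congr (_ + _); exact: esym (scalerA _ _ _).
have [|l lE] := injJ (f := linear_map lin_f) (linear_map lin_h).
  move=> u v /= /eqP; rewrite -subr_eq0 -[f u - f v](linearB (linear_map lin_f)).
  have [u' uE] := quot_proj_surj (u - v); rewrite uE /= fE => /eqP ax0.
  by apply/eqP; rewrite -subr_eq0 uE; apply/eqP/quot_proj_eq0.
exists l => lw0; have := lE (quot_proj idI 1).
by rewrite /= fE hE !scale1r linearZ/= lw0 scaler0 => /esym.
Qed.

Lemma separating_functional (V : lmodType R) (S : V -> Prop) (w : V) :
  submodule S -> ~ S w ->
  exists l : {linear V -> J}, (forall v, S v -> l v = 0) /\ l w <> 0.
Proof.
move=> subS nSw; have [|l lw] := nonzero_functional (w := quot_proj subS w).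
  by move/quot_proj_eq0.
exists (l \o quot_proj subS : {linear V -> J}); split=> //= v Sv.
by have /= -> := (quot_proj_eq0 subS v).2 Sv; rewrite linear0.
Qed.
End Cogenerator.

(** * Dual bases and the Auslander-Reiten translate *)

Section DualBasis.
Variable A : pzRingType.

Definition dual_basis (P : lmodType A) n (e : 'I_n -> P)
    (x : 'I_n -> {linear P -> A^o}) : Prop :=
  forall p, p = \sum_i (x i p : A) *: e i.

Lemma projective_dual_basis (P : lmodType A) : fg P -> projective P ->
  exists n (e : 'I_n -> P) x, dual_basis e x.
Proof.
move=> [n [e Pe]] projP.
pose comb (c : copies A^o n) : P := \sum_i (c i : A) *: e i.
have lin_comb : linear comb.
  move=> a c d; rewrite /comb scaler_sumr -big_split; apply: eq_bigr => i _.
  by rewrite !ffunE /= scalerDl scalerA.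
have [|s sE] := projP _ _ (linear_map lin_comb) (idfun : {linear P -> P}).
  move=> p; have [c ->] := Pe p; exists [ffun i => c i].
  by apply: eq_bigr => i _; rewrite ffunE.
have lin_coord i : linear (fun p => s p i : A^o).
  by move=> a p q; rewrite linearP !ffunE.
by exists n, e, (fun i => linear_map (lin_coord i)) => p; rewrite -[LHS]sE.
Qed.

Section FromDualBasis.
Variables (P : lmodType A) (n : nat) (e : 'I_n -> P).
Variable (x : 'I_n -> {linear P -> A^o}).
Hypothesis ex : dual_basis e x.

Lemma dual_basis_fg : fg P.
Proof. by exists n, e => p; exists (fun i => x i p); apply: ex. Qed.

Lemma dual_basis_projective : projective P.
Proof.
move=> U V g u g_surj.
have /choice[y yE] : forall i, exists y, g y = u (e i) by move=> i; apply: g_surj.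
pose v p : U := \sum_i (x i p : A) *: y i.
have lin_v : linear v.
  move=> a p q; rewrite /v scaler_sumr -big_split; apply: eq_bigr => i _.
  by rewrite linearP /= scalerDl scalerA.
exists (linear_map lin_v) => p /=.
rewrite linear_sum {2}(ex p) linear_sum.
by apply: eq_bigr => i _; rewrite !linearZ /= yE.
Qed.

Lemma dual_basis_eval (N : lmodType A) (w : {linear P -> N}) p :
  w p = \sum_i (x i p : A) *: w (e i).
Proof. by rewrite {1}(ex p) linear_sum; apply: eq_bigr => i _; rewrite linearZ. Qed.
End FromDualBasis.
End DualBasis.

Section RankOne.
Variables (A : pzRingType) (P N : lmodType A) (u : dual P) (n : N).
Definition rank_one_fun (p : P) : N := ((u : {linear P -> A^o}) p : A) *: n.
Fact rank_one_linear : linear rank_one_fun.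
Proof. by move=> a p q; rewrite /rank_one_fun linearP scalerDl scalerA. Qed.
Definition rank_one := linear_map rank_one_linear.
End RankOne.

(** Surjectivity of [Hom(f, N)].  It is used for the differential [P1 -> P0],
    where it is the pivot of the whole equivalence, for the inclusion of a
    syzygy, where it is the vanishing of [Ext^1], and for minimal presentations
    over [End(X)^op], where it is tau-rigidity. *)
Definition factors_through (A : pzRingType) (P1 P0 : lmodType A)
    (f : {linear P1 -> P0}) (N : lmodType A) : Prop :=
  forall w : {linear P1 -> N}, exists v : {linear P0 -> N}, forall x, w x = v (f x).

(** The parameter [phi] records in the type through which map the base ring
    acts. *)
Definition homR (R : comPzRingType) (A : pzRingType) (phi : alg_str R A)
  (P N : lmodType A) : Type := {linear P -> N}.

Section HomModuleOverBase.
Variables (R : comPzRingType) (A : pzRingType) (phi : alg_str R A).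
Variables P N : lmodType A.
Local Notation homR := (homR phi P N).

HB.instance Definition _ := GRing.Zmodule.on homR.

Section Scale.
Variables (r : R) (w : homR).
Definition homR_scale_fun (x : P) : N := phi r *: (w : {linear P -> N}) x.
Fact homR_scale_linear : linear homR_scale_fun.
Proof.
by move=> a x y; rewrite /homR_scale_fun linearP scalerDr !scalerA alg_mapC.
Qed.
Definition homR_scale : homR := linear_map homR_scale_linear.
End Scale.

Fact homR_scaleA r s w : homR_scale r (homR_scale s w) = homR_scale (r * s) w.
Proof. by apply: linear_ext => x /=; rewrite /homR_scale_fun rmorphM scalerA. Qed.
Fact homR_scale1 : left_id 1 homR_scale.
Proof. by move=> w; apply: linear_ext => x /=; rewrite /homR_scale_fun rmorph1 scale1r. Qed.
Fact homR_scaleDr : right_distributive homR_scale +%R.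
Proof. by move=> r u v; apply: linear_ext => x; apply: scalerDr. Qed.
Fact homR_scaleDl w : {morph homR_scale^~ w : r s / r + s}.
Proof. by move=> r s; apply: linear_ext => x /=; rewrite /homR_scale_fun rmorphD scalerDl. Qed.
HB.instance Definition _ := GRing.Zmodule_isLmodule.Build R homR
  homR_scaleA homR_scale1 homR_scaleDr homR_scaleDl.
End HomModuleOverBase.

Section HomToTau.
Variables (R : comPzRingType) (A : pzRingType) (phi : alg_str R A).
Variables (artR : artinian R) (J : lmodType R) (iota : {linear Rtop R -> J}).
Hypotheses (iota_inj : injective iota) (injJ : injective_module J).
Variables (P1 P0 N : lmodType A) (f : {linear P1 -> P0}).
Hypotheses (fgP1 : fg P1) (prP1 : projective P1).
Hypotheses (fgP0 : fg P0) (prP0 : projective P0).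

Let piTr := quot_proj (im_submodule (transpose f)).

(** For [P1] finitely generated projective the class of [u] in [Tr f] paired
    with [n] only depends on the rank one map [u(-) n]: this is the
    isomorphism [P1^* (x) N = Hom(P1, N)], and summing over a dual basis
    extends the pairing to all of [Hom(P1, N)].  The maps that factor through
    [f] are paired to zero because [u o f] is zero in [Tr f]. *)
Lemma factors_through_hom_tau0 :
  factors_through f N -> forall (h : {linear N -> tau phi J f}) n, h n = 0.
Proof.
move=> fac h n.
have [m1 [e1 [x1 ex1]]] := projective_dual_basis fgP1 prP1.
have [m0 [e0 [x0 ex0]]] := projective_dual_basis fgP0 prP0.
pose ev (k : N) (c : Tr f) : J :=
  (h k : {linear restr (opp_alg phi) (Tr f) -> J}) c.
have evD k k' c : ev (k + k') c = ev k c + ev k' c by rewrite /ev linearD.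
have ev0 c : ev 0 c = 0 by rewrite /ev linear0.
have evDr k c c' : ev k (c + c') = ev k c + ev k c' by exact: linearD.
have ev0r k : ev k 0 = 0 by exact: linear0.
have evZ k (a : A) c : ev k ((a : A^c) *: c) = ev (a *: k) c by rewrite /ev linearZ.
pose Phi (w : {linear P1 -> N}) : J := \sum_i ev (w (e1 i)) (piTr (x1 i)).
have Phi_rank_one (u : dual P1) k : Phi (rank_one u k) = ev k (piTr u).
  have uE : u = \sum_i ((u : {linear P1 -> A^o}) (e1 i) : A^c) *: (x1 i : dual P1).
    apply: linear_ext => p; rewrite (dual_basis_eval ex1 u p).
    by elim/big_rec2: _ => //= i y s _ ->.
  rewrite {2}uE linear_sum /Phi /=.
  have -> : ev k (\sum_i piTr (((u : {linear P1 -> A^o}) (e1 i) : A^c) *: (x1 i : dual P1)))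
    = \sum_i ev k (piTr (((u : {linear P1 -> A^o}) (e1 i) : A^c) *: (x1 i : dual P1))).
    by elim/big_rec2: _ => // i y s _ <-; rewrite evDr.
  by apply: eq_bigr => i _; rewrite linearZ /= evZ.
apply: linear_ext => c.
have [u ->] := quot_proj_surj c.
rewrite -[LHS]/(ev n (piTr u)) -Phi_rank_one.
have [v vE] := fac (rank_one u n).
have -> : Phi (rank_one u n)
    = \sum_j Phi (rank_one (transpose f (x0 j)) (v (e0 j))).
  rewrite exchange_big /=; apply: eq_bigr => i _.
  rewrite vE (dual_basis_eval ex0 v).
  by elim/big_rec2: _ => // j y s _ <-; rewrite evD.
rewrite big1 // => j _; rewrite Phi_rank_one.
have -> : piTr (transpose f (x0 j)) = 0 by apply/quot_proj_eq0; exists (x0 j).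
exact: ev0r.
Qed.

(** Conversely a functional on [Hom(P1, N)] that vanishes on the maps through
    [f] but not on [w] is, by the same pairing, a nonzero map [N -> tau f]. *)
Lemma hom_tau0_factors_through :
  (forall (h : {linear N -> tau phi J f}) n, h n = 0) -> factors_through f N.
Proof.
move=> tau0 w; apply: contrapT => nw.
pose S (u : homR phi P1 N) :=
  exists v : {linear P0 -> N}, forall x, (u : {linear P1 -> N}) x = v (f x).
have subS : submodule S.
  split=> [|r u u' [v vE] [v' v'E]].
    by exists (\0 : {linear P0 -> N}).
  exists ((homR_scale r (v : homR phi P0 N) : {linear P0 -> N}) + v') => x.
  by rewrite /= /homR_scale_fun vE v'E.
have [l [lS lw]] := separating_functional artR iota_inj injJ subS nw.
pose pair (n : N) (u : dual P1) : J := l (rank_one u n : homR phi P1 N).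
have /choice[h hE] : forall n, exists h : Tr f -> J, forall u, h (piTr u) = pair n u.
  move=> n; apply: quot_lift => [u u'|_ [u <-]].
    rewrite /pair -linearB; congr (l _); apply: linear_ext => x.
    by rewrite /= /rank_one_fun /= scalerBl.
  by apply: lS; exists (rank_one u n).
have lin_h n : linear (h n : restr (opp_alg phi) (Tr f) -> J).
  move=> r c c'; have [u ->] := quot_proj_surj c; have [u' ->] := quot_proj_surj c'.
  rewrite -[r *: _]/(opp_alg phi r *: piTr u) -[_ + _]linearP !hE /pair -linearP.
  congr (l _); apply: linear_ext => x.
  by rewrite /= /rank_one_fun /= /dual_scale_fun scalerDl /homR_scale_fun
    /rank_one_fun scalerA /= alg_mapC.
pose H n : tau phi J f := linear_map (lin_h n).
have lin_H : linear H.
  move=> a n n'; apply: linear_ext => c; have [u ->] := quot_proj_surj c.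
  rewrite /= /jdual_scale_fun /= -[_ *: quot_proj _ _]linearZ !hE /pair -linearD.
  congr (l _); apply: linear_ext => x.
  by rewrite /= /rank_one_fun /= /dual_scale_fun scalerDr scalerA.
apply: lw.
have [m1 [e1 [x1 ex1]]] := projective_dual_basis fgP1 prP1.
have -> : (w : homR phi P1 N) = \sum_i (rank_one (x1 i) (w (e1 i)) : homR phi P1 N).
  apply: linear_ext => x; rewrite (dual_basis_eval ex1 w).
  by elim/big_rec2: _ => // i y s _ ->.
rewrite linear_sum big1 // => i _.
rewrite -[LHS]/(pair _ _) -hE.
have := tau0 (linear_map lin_H) (w (e1 i)).
by move=> /(congr1 (fun g : {linear restr (opp_alg phi) (Tr f) -> J} => g (piTr (x1 i)))).
Qed.
End HomToTau.

(** * Comparison of projective presentations *)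

(** The map to be lifted lands in the kernel of [g], onto which [f] is
    surjective. *)
Lemma projective_lift_exact (A : pzRingType) (P U V W : lmodType A)
    (f : {linear U -> V}) (g : {linear V -> W}) (u : {linear P -> V}) :
  projective P -> exact_at f g -> (forall x, g (u x) = 0) ->
  exists v : {linear P -> U}, forall x, f (v x) = u x.
Proof.
move=> prP fg_ex gu0.
have [f' f'E] : exists f' : {linear U -> ker_mod g}, forall x, ker_in g (f' x) = f x.
  apply: im_inverse (@ker_in_inj _ _ _ g) _ => x.
  by apply/ker_in_exact/fg_ex; exists x.
have [u' u'E] : exists u' : {linear P -> ker_mod g}, forall x, ker_in g (u' x) = u x.
  by apply: im_inverse (@ker_in_inj _ _ _ g) _ => x; apply/ker_in_exact.
have [|v vE] := prP _ _ f' u'.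
  move=> z; have /fg_ex[x xE] : g (ker_in g z) = 0 by apply/ker_in_exact; exists z.
  by exists x; apply: (@ker_in_inj _ _ _ g); rewrite f'E.
by exists v => x; rewrite -f'E vE u'E.
Qed.

Lemma bijective_linear_inverse (A : pzRingType) (U V : lmodType A)
    (f : {linear U -> V}) :
  bijective f -> exists g : {linear V -> U}, cancel f g /\ cancel g f.
Proof.
move=> [g fK gK]; have lin_g : linear g.
  by move=> a x y; apply: (can_inj fK); rewrite gK linearP !gK.
by exists (linear_map lin_g).
Qed.

(** The comparison maps between the two presentations are inverse to each
    other up to automorphisms, by right minimality of [f] and [g]; so [Q1] is
    a summand of [P1], compatibly with the presentations. *)
Lemma minimal_presentation_factors_through (A : pzRingType)
    (Q1 Q0 P1 P0 N : lmodType A)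
    (f : {linear Q1 -> Q0}) (g : {linear Q0 -> N})
    (f' : {linear P1 -> P0}) (g' : {linear P0 -> N}) :
  minimal_presentation f g ->
  projective P1 -> projective P0 ->
  exact_at f' g' -> (forall y, exists x, g' x = y) ->
  factors_through f' N -> factors_through f N.
Proof.
move=> [[_ prQ1] [_ prQ0] [fg_ex g_surj] f_min g_min] prP1 prP0 fg'_ex g'_surj fac w.
have gf0 x : g (f x) = 0 by apply/fg_ex; exists x.
have gf'0 x : g' (f' x) = 0 by apply/fg'_ex; exists x.
have [a aE] := prQ0 _ _ g' g g'_surj.
have [b bE] := prP0 _ _ g g' g_surj.
have [a1 a1E] : exists a1 : {linear Q1 -> P1}, forall x, f' (a1 x) = a (f x).
  apply: (projective_lift_exact (u := a \o f : {linear Q1 -> P0}) prQ1 fg'_ex) => x.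
  by rewrite /= aE.
have [b1 b1E] : exists b1 : {linear P1 -> Q1}, forall x, f (b1 x) = b (f' x).
  apply: (projective_lift_exact (u := b \o f' : {linear P1 -> Q0}) prP1 fg_ex) => x.
  by rewrite /= bE.
have /bijective_linear_inverse[c [baK cK]] : bijective (b \o a : {linear Q0 -> Q0}).
  by apply: g_min => x; rewrite /= bE aE.
have gc x : g (c x) = g x by rewrite -[in RHS](cK x) /= bE aE.
have [d dE] : exists d : {linear Q1 -> Q1}, forall x, f (d x) = c (f x).
  apply: (projective_lift_exact (u := c \o f : {linear Q1 -> Q0}) prQ1 fg_ex) => x.
  by rewrite /= gc.
have /bijective_linear_inverse[e [dbaK _]] :
    bijective (d \o (b1 \o a1) : {linear Q1 -> Q1}).
  by apply: f_min => x; rewrite /= dE b1E a1E (baK (f x)).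
have [v vE] := fac (w \o e \o d \o b1 : {linear P1 -> N}).
exists (v \o a : {linear Q0 -> N}) => x.
by rewrite /= -a1E -vE /= (dbaK x).
Qed.

(** * Summands of finite powers and relative projectives *)

Section Summand.
Variables (A : pzRingType) (X : lmodType A).

(** [i] and [p] are the components of a split embedding of [Z] into a finite
    power of [X] and of its retraction; for the regular module this is a dual
    basis. *)
Definition X_coordinates (Z : lmodType A) n
    (i : 'I_n -> {linear Z -> X}) (p : 'I_n -> {linear X -> Z}) : Prop :=
  forall z, z = \sum_k p k (i k z).

Definition copy_in_fun n (k : 'I_n) (x : X) : copies X n :=
  [ffun j => if j == k then x else 0].
Fact copy_in_linear n (k : 'I_n) : linear (copy_in_fun k).
Proof.
move=> a x y; apply/ffunP => j; rewrite !ffunE.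
by case: eqP => // _; rewrite scaler0 addr0.
Qed.
Definition copy_in n (k : 'I_n) := linear_map (copy_in_linear k).

Fact copy_out_linear n (k : 'I_n) : linear (fun y : copies X n => y k).
Proof. by move=> a x y; rewrite !ffunE. Qed.
Definition copy_out n (k : 'I_n) := linear_map (@copy_out_linear n k).

Lemma copies_coordinates n : X_coordinates (@copy_out n) (@copy_in n).
Proof.
move=> y; apply/ffunP => j; rewrite sum_ffunE (bigD1 j) //= big1 ?addr0.
  by rewrite ffunE eqxx.
by move=> k kj; rewrite ffunE eq_sym (negPf kj).
Qed.

Lemma in_add_coordinates (Z : lmodType A) : in_add X Z ->
  exists n (i : 'I_n -> {linear Z -> X}) p, X_coordinates i p.
Proof.
move=> [n [N [f /bijective_linear_inverse[g [fK gK]]]]].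
have lin_p : linear (fun y => (f y).1) by move=> a x y; rewrite linearP.
have lin_i : linear (fun z : Z => g (z, 0)).
  move=> a x y; rewrite -linearP; congr (g _).
  by rewrite [RHS]surjective_pairing /= scaler0 addr0.
pose p := linear_map lin_p; pose i := linear_map lin_i.
exists n, (fun k => copy_out k \o i : {linear Z -> X}),
  (fun k => p \o copy_in k : {linear X -> Z}) => z.
have {1}-> : z = p (i z) by rewrite /= gK.
by rewrite {1}(copies_coordinates (i z)) linear_sum.
Qed.

Lemma copies_in_add n : in_add X (copies X n).
Proof.
exists n, (copies X 0).
have lin_f : linear (fun y : copies X n => (y, 0 : copies X 0)).
  move=> a x y; rewrite [RHS]surjective_pairing /=.
  by congr (_, _); rewrite scaler0 addr0.
exists (linear_map lin_f), fst => // -[y z] /=; congr (_, _).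
by apply/ffunP => -[].
Qed.

Lemma isomorphic_in_add (Z Z' : lmodType A) : isomorphic Z Z' -> in_add X Z -> in_add X Z'.
Proof.
move=> [h [h' hK h'K]] [n [N [f [f' fK f'K]]]]; exists n, N.
have lin_k : linear (fun y : copies X n => (h (f y).1, (f y).2)).
  by move=> a x y; rewrite !linearP.
exists (linear_map lin_k), (fun q => f' (h' q.1, q.2)) => [y|[z z']] /=.
  by rewrite hK -surjective_pairing.
by rewrite f'K h'K.
Qed.

Lemma self_in_add : in_add X X.
Proof.
apply: isomorphic_in_add (copies_in_add 1).
exists (copy_out ord0 : {linear copies X 1 -> X}), (copy_in ord0) => [y|x] /=.
  by apply/ffunP => j; rewrite !ffunE (ord1 j).
by rewrite ffunE eqxx.
Qed.

Lemma in_add_copies0 (Z : lmodType A) : in_add X (copies Z 0).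
Proof.
apply: isomorphic_in_add (copies_in_add 0).
exists (\0 : {linear copies X 0 -> copies Z 0}), (fun=> 0) => [y|x];
  by apply/ffunP => -[].
Qed.

Lemma short_exact_lift (Z U V W : lmodType A) (f : {linear U -> V})
    (g : {linear V -> W}) (v : {linear Z -> V}) :
  short_exact f g -> (forall z, g (v z) = 0) ->
  exists u : {linear Z -> U}, forall z, f (u z) = v z.
Proof. by move=> [f_inj fg_ex _] gv; apply: im_inverse => // z; apply/fg_ex. Qed.

Lemma Hom_exact_of_lift (Z U V W : lmodType A) (f : {linear U -> V})
    (g : {linear V -> W}) :
  short_exact f g ->
  (forall w : {linear Z -> W}, exists v : {linear Z -> V}, forall z, g (v z) = w z) ->
  Hom_exact Z f g.
Proof.
move=> ex lift; split=> // [u u' uu' z|v].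
  by have [f_inj _ _] := ex; apply: f_inj.
split=> [|[u uE] z]; first exact: short_exact_lift.
by case: ex => _ fg_ex _; apply/fg_ex; exists (u z).
Qed.

Lemma X_coordinates_lift (Z V W : lmodType A) n (i : 'I_n -> {linear Z -> X})
    (p : 'I_n -> {linear X -> Z}) (g : {linear V -> W}) :
  X_coordinates i p ->
  (forall w : {linear X -> W}, exists v : {linear X -> V}, forall x, g (v x) = w x) ->
  forall w : {linear Z -> W}, exists v : {linear Z -> V}, forall z, g (v z) = w z.
Proof.
move=> ip lift w.
have /choice[v vE] : forall k, exists v : {linear X -> V}, forall x, g (v x) = w (p k x).
  by move=> k; apply: (lift (w \o p k : {linear X -> W})).
exists (\sum_k (v k \o i k : {linear Z -> V})) => z.
rewrite lin_sumE linear_sum {2}(ip z) linear_sum.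
by apply: eq_bigr => k _ /=; rewrite vE.
Qed.

Lemma F_projective_lift (Z U V W : lmodType A) (f : {linear U -> V})
    (g : {linear V -> W}) (w : {linear Z -> W}) :
  F_projective X Z -> F_exact X f g ->
  exists v : {linear Z -> V}, forall z, g (v z) = w z.
Proof. by move=> [_ prZ] /prZ[]. Qed.
End Summand.

Section ArtinAlgebra.
Variables (R : comPzRingType) (L : pzRingType) (phi : alg_str R L).
Hypothesis hL : artin_algebra phi.

Lemma fg_restr (V : lmodType L) : fg V -> fg (restr phi V : lmodType R).
Proof.
move=> [n [e Ve]]; have [_ [m [a La]]] := hL.
apply: (fg_fin (e := fun p : 'I_n * 'I_m => (a p.2 : L) *: e p.1 : restr phi V)) => x.
have [b ->] := Ve x.
have /choice[c bE] : forall i, exists c : 'I_m -> R,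
    (b i : restr phi L^o) = \sum_j c j *: a j by move=> i; apply: La.
exists (fun p => c p.1 p.2).
rewrite -(pair_bigA _ (fun i j => c i j *: ((a j : L) *: e i : restr phi V))) /=.
apply: eq_bigr => i _; rewrite [b i]bE.
transitivity (\sum_j ((c i j *: a j : restr phi L^o) : L) *: e i).
  exact: (scaler_suml (e i) _ _ (fun j => (c i j *: a j : restr phi L^o) : L)).
by apply: eq_bigr => j _; rewrite -[RHS]/(phi (c i j) *: (_ *: e i)) scalerA.
Qed.

Lemma restr_noetherian (V : lmodType L) : fg V -> noetherian (restr phi V : lmodType R).
Proof.
by move=> /fg_restr; apply: noetherian_fg; apply: artinian_noetherian; case: hL.
Qed.

Lemma fg_ker (U V : lmodType L) (g : {linear U -> V}) : fg U -> fg (ker_mod g).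
Proof.
move=> /restr_noetherian/(_ (fun x => g x = 0))[|s sP].
  split=> [|r x y gx gy]; first exact: linear0.
  by rewrite -[r *: x]/(phi r *: (x : U)) linearP gx gy scaler0 addr0.
have /choice[e eE] : forall k : 'I_(size s), exists e : ker_mod g,
    ker_in g e = tnth (in_tuple s) k.
  by move=> k; apply/ker_in_exact/sP/span_mem/mem_tnth.
exists (size s), e => x.
have /sP/span_combination[c cE] : g (ker_in g x) = 0 by apply/ker_in_exact; exists x.
exists (fun k => phi (c k)); apply: (@ker_in_inj _ _ _ g).
rewrite cE linear_sum; apply: eq_bigr => k _.
by rewrite linearZ eE.
Qed.

(** A map out of [X] is determined by its values on generators of [X], so
    [Hom(X, Q)] embeds into a finite power of [Q], which is a noetherian
    module over the base ring. *)
Lemma Hom_generators (X Q : lmodType L) : fg X -> fg Q ->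
  exists n (h : 'I_n -> {linear X -> Q}), forall u : {linear X -> Q},
    exists t : 'I_n -> {linear X -> X}, forall x, u x = \sum_k h k (t k x).
Proof.
move=> [m [e Xe]] fgQ.
pose V : lmodType R := copies (restr phi Q) m.
have noethV : noetherian V.
  apply: noetherian_fg; first by apply: artinian_noetherian; case: hL.
  exact/fg_copies/fg_restr.
pose S (v : V) := exists u : {linear X -> Q}, forall i, v i = u (e i).
have [|s sP] := noethV S.
  split=> [|r v v' [u uE] [u' u'E]].
    by exists (\0 : {linear X -> Q}) => i; rewrite ffunE.
  exists ((u \o homothety phi X r : {linear X -> Q}) + u') => i.
  by rewrite !ffunE uE u'E /= /homothety_fun linearZ.
have /choice[h hE] : forall k : 'I_(size s), exists h : {linear X -> Q},
    forall i, tnth (in_tuple s) k i = h (e i).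
  by move=> k; apply/sP/span_mem/mem_tnth.
exists (size s), h => u.
have /sP/span_combination[c cE] : S [ffun i => u (e i)].
  by exists u => i; rewrite ffunE.
exists (fun k => homothety phi X (c k)) => x; have [b ->] := Xe x.
pose u' : {linear X -> Q} := \sum_k (h k \o homothety phi X (c k) : {linear X -> Q}).
suffices uu' i : u (e i) = u' (e i).
  have <- y : u' y = \sum_k h k (homothety phi X (c k) y) by rewrite lin_sumE.
  by rewrite !linear_sum; apply: eq_bigr => i _; rewrite !linearZ /= uu'.
have /ffunP/(_ i) := cE; rewrite ffunE => ->.
rewrite sum_ffunE lin_sumE; apply: eq_bigr => k _.
by rewrite ffunE hE /= /homothety_fun linearZ.
Qed.

(** A finite generating set of [Hom(X, Q)] over [End(X)] is a right
    [add X]-approximation [X^n -> Q]; it is onto because [X] generates [Q],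
    so its kernel sequence is F-exact, and it splits as [Q] is F-projective. *)
Lemma F_projective_in_add (X Q : lmodType L) :
  additive_generator X -> F_projective X Q -> in_add X Q.
Proof.
move=> [fgX genX] prQ; have [fgQ _] := prQ.
have [n [h hP]] := Hom_generators fgX fgQ.
pose g : {linear copies X n -> Q} := \sum_k (h k \o copy_out X k : {linear copies X n -> Q}).
have gE y : g y = \sum_k h k (y k) by rewrite lin_sumE.
have g_lift (w : {linear X -> Q}) :
    exists v : {linear X -> copies X n}, forall x, g (v x) = w x.
  have [t tE] := hP w.
  have lin_v : linear (fun x => [ffun k => t k x] : copies X n).
    by move=> a x y; apply/ffunP => k; rewrite !ffunE linearP.
  exists (linear_map lin_v) => x; rewrite gE tE.
  by apply: eq_bigr => k _; rewrite /= ffunE.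
have g_surj z : exists y, g y = z.
  have /genX[m [f f_surj]] := fgQ; have [y <-] := f_surj z.
  have [v vE] := X_coordinates_lift (@copies_coordinates _ X m) g_lift f.
  by exists (v y).
have ex : short_exact (ker_in g) g.
  by split; [apply: ker_in_inj|apply: ker_in_exact|].
have fgXn : fg (copies X n) by apply: fg_copies.
have F_ex : F_exact X (ker_in g) g.
  split=> // [|Z /in_add_coordinates[m [i [p ip]]]].
    by split=> //; apply: fg_ker.
  by apply: Hom_exact_of_lift => //; apply: X_coordinates_lift ip g_lift.
have [s sE] := F_projective_lift (idfun : {linear Q -> Q}) prQ F_ex.
have [r rE] : exists r : {linear copies X n -> ker_mod g},
    forall y, ker_in g (r y) = y - s (g y).
  apply: (short_exact_lift (v := (idfun : {linear copies X n -> copies X n})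
    - (s \o g : {linear copies X n -> copies X n})) ex) => y.
  by rewrite /= linearB sE subrr.
exists n, (ker_mod g).
have lin_f : linear (fun y => (g y, r y)) by move=> a y z; rewrite !linearP.
exists (linear_map lin_f), (fun q => s q.1 + ker_in g q.2) => [y|[z k]].
  by rewrite /= -[val _]/(ker_in g _) rE addrC subrK.
have gk : g (ker_in g k) = 0 by apply/ker_in_exact; exists k.
have gsk : g (s z + ker_in g k) = z by rewrite linearD sE gk addr0.
congr (_, _); first exact: gsk.
by apply: (@ker_in_inj _ _ _ g); rewrite rE gsk addrC addKr.
Qed.
End ArtinAlgebra.

(** * The functor Hom(X, -) *)

Section HomFunctor.
Variables (A : pzRingType) (X : lmodType A).

Section Push.
Variables (V W : lmodType A) (g : {linear V -> W}).
Definition push_fun (u : homX X V) : homX X W :=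
  (g \o (u : {linear X -> V}) : X -> W) : {linear X -> W}.
Fact push_linear : linear push_fun.
Proof. by move=> t u v; apply: linear_ext => x; rewrite /= linearD. Qed.
Definition push := linear_map push_linear.
End Push.

Section Coordinates.
Variables (P : lmodType A) (n : nat).
Variables (i : 'I_n -> {linear P -> X}) (p : 'I_n -> {linear X -> P}).
Hypothesis ip : X_coordinates i p.

Fact push_coordinate_linear k :
  linear (fun u : homX X P =>
    (i k \o (u : {linear X -> P}) : {linear X -> X}) : (endop X)^o).
Proof. by move=> t u v; apply: linear_ext => x; rewrite /= linearD. Qed.

(** The coordinates of [u] are the endomorphisms [i k \o u] of [X]; so
    [Hom(X, P)] is finitely generated projective whenever [P] is a summand of a
    finite power of [X]. *)
Lemma push_dual_basis :
  dual_basis (fun k => p k : homX X P)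
    (fun k => linear_map (@push_coordinate_linear k)).
Proof.
move=> u; apply: linear_ext => x; rewrite {1}(ip ((u : {linear X -> P}) x)).
by elim/big_rec2: _ => //= k y v _ ->.
Qed.

(** The maps [p j] generate [Hom(X, P)] over [End(X)], so [k] is composition
    with the map assembled from the [k (p j)]. *)
Lemma push_full (N : lmodType A) (k : {linear homX X P -> homX X N}) :
  exists c : {linear P -> N}, forall u, k u = push c u.
Proof.
pose c : {linear P -> N} :=
  \sum_j (((k (p j) : {linear X -> N}) \o i j) : {linear P -> N}).
exists c => u; rewrite (dual_basis_eval push_dual_basis k u).
apply: linear_ext => x; rewrite /= /c !lin_sumE; exact: eq_bigr.
Qed.

Lemma push_faithful (N : lmodType A) (c c' : {linear P -> N}) :
  (forall u : homX X P, push c u = push c' u) -> forall y, c y = c' y.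
Proof.
move=> cc' y; rewrite (ip y) !linear_sum; apply: eq_bigr => j _.
exact: (congr1 (fun h : {linear X -> N} => h (i j y)) (cc' (p j))).
Qed.

Lemma push_right_minimal (N : lmodType A) (g : {linear P -> N}) :
  right_minimal g -> right_minimal (push g).
Proof.
move=> g_min k gk; have [c kE] := push_full k.
have [|d [cK dK]] := bijective_linear_inverse (f := c).
  apply: g_min; apply: (push_faithful (c := g \o c : {linear P -> N})) => u.
  by rewrite -[in RHS]gk kE; apply: linear_ext.
exists (push d) => u; rewrite ?kE; apply: linear_ext => x /=.
  by rewrite cK.
by rewrite dK.
Qed.

End Coordinates.

Lemma factors_through_push (P Q N : lmodType A) (f : {linear P -> Q})
    n (i : 'I_n -> {linear P -> X}) (p : 'I_n -> {linear X -> P})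
    m (i' : 'I_m -> {linear Q -> X}) (p' : 'I_m -> {linear X -> Q}) :
  X_coordinates i p -> X_coordinates i' p' ->
  (factors_through (push f) (homX X N : lmodType (endop X))
     <-> factors_through f N).
Proof.
move=> ip ip'; split=> fac w.
  have [k kE] := fac (push w); have [v vE] := push_full ip' k.
  exists v; apply: (push_faithful ip (c' := v \o f : {linear P -> N})) => u.
  by rewrite kE vE; apply: linear_ext.
have [c wE] := push_full ip w; have [v vE] := fac c.
by exists (push v) => u; rewrite wE; apply: linear_ext => x; rewrite /= vE.
Qed.
End HomFunctor.

(** * Two-term complexes *)

Section TwoTermPresilting.
Variables (A : pzRingType) (X P1 P0 : lmodType A) (f : {linear P1 -> P0}).
Hypotheses (addP1 : in_add X P1) (addP0 : in_add X P0).

Lemma two_obj_trivial (i : int) :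
  i != 0 -> i != -1 -> forall x y : two_term f i, x = y.
Proof. by case: i => [[|i]|[|i]] // _ _ x y; apply/ffunP => -[]. Qed.

Lemma two_term_in_Kb_add : in_Kb_add X (two_term f).
Proof.
split=> [[[|i]|[|i]] //=|]; try exact: in_add_copies0.
exists 1%N => i i1 x; apply: two_obj_trivial; lia.
Qed.

Definition degree_one_map (h : {linear P1 -> P0}) (i : int) :
    {linear two_term f i -> shift (two_term f) 1 i} :=
  match i as i' return {linear two_obj P1 P0 i' -> two_obj P1 P0 (i' + 1)} with
  | Negz 0 => h
  | _ => \0
  end.

Fact degree_one_map_comm h i j (x : two_term f i) :
  degree_one_map h j (diff (two_term f) i j x)
    = diff (shift (two_term f) 1) i j (degree_one_map h i x).
Proof.
rewrite [RHS]shift_diffE.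
case: i j x => [[|i]|[|i]] [[|j]|[|j]] x //=; rewrite ?linear0 ?mul0rz //.
Qed.

Definition degree_one_homotopy (s : {linear P1 -> P1}) (t : {linear P0 -> P0})
    (i j : int) : {linear two_term f i -> shift (two_term f) 1 j} :=
  match i as i', j as j'
    return {linear two_obj P1 P0 i' -> two_obj P1 P0 (j' + 1)} with
  | Negz 0, Negz 1 => s
  | Posz 0, Negz 0 => t
  | _, _ => \0
  end.

(** In positive degrees the only possibly nonzero component of a map from the
    complex to a shift of it is [P1 -> P0], in degree one. *)
Lemma two_term_presilting :
  presilting X (two_term f) <->
  forall h : {linear P1 -> P0}, exists (s : {linear P1 -> P1}) (t : {linear P0 -> P0}),
    forall x, h x = f (s x) + t (f x).
Proof.
split=> [[_ /(_ 1 erefl) hom0] h|fac].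
  have [k kE] := hom0 (ChainMap (degree_one_map_comm h)).
  pose s : {linear P1 -> P1} := k (Negz 0) (Negz 1).
  (* the differential of the shift by one carries a sign *)
  exists (- s), (k (Posz 0) (Negz 0)) => x.
  have := kE (Negz 0) x; rewrite shift_diffE /= => ->.
  by congr (_ + _); rewrite expr1 mulrN1z linearN.
split=> [|k k0 g]; first exact: two_term_in_Kb_add.
have [k1|k1] := eqVneq k 1; last first.
  exists (fun _ _ => \0) => i x.
  have [i0|i0] := eqVneq i 0; first by apply: two_obj_trivial; lia.
  have [i1|i1] := eqVneq i (-1); first by apply: two_obj_trivial; lia.
  by rewrite [x](two_obj_trivial i0 i1 x 0) !linear0 addr0.
subst k; have [s [t stE]] := fac (g (Negz 0)).
exists (degree_one_homotopy (- s) t) => i x.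
have [i0|i0] := eqVneq i 0; first by apply: two_obj_trivial; lia.
have [i1|i1] := eqVneq i (-1).
  rewrite i1 in x *; rewrite [g _ x]stE shift_diffE.
  by congr (_ + _); rewrite /= expr1 mulrN1z linearN opprK.
by rewrite [x](two_obj_trivial i0 i1 x 0) !linear0 addr0.
Qed.
End TwoTermPresilting.

(** * Relative resolutions *)

Lemma factor_surjection (A : pzRingType) (V W N : lmodType A)
    (g : {linear V -> W}) (u : {linear V -> N}) :
  (forall z, exists y, g y = z) -> (forall y, g y = 0 -> u y = 0) ->
  exists v : {linear W -> N}, forall y, v (g y) = u y.
Proof.
move=> /choice[s gs] ker_u.
have u_sg y : u (s (g y)) = u y.
  by apply/eqP; rewrite -subr_eq0 -linearB ker_u // linearB gs subrr.
have lin_us : linear (fun z => u (s z)).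
  move=> a x y; rewrite -linearP -[RHS]u_sg; congr (u (s _)).
  by rewrite linearP !gs.
by exists (linear_map lin_us).
Qed.

Lemma right_minimal_comp_inj (A : pzRingType) (U V W : lmodType A)
    (g : {linear U -> V}) (f : {linear V -> W}) :
  injective f -> right_minimal g -> right_minimal (f \o g : {linear U -> W}).
Proof. by move=> f_inj g_min h fgh; apply: g_min => x; apply/f_inj/fgh. Qed.

(** Schanuel's argument: the two middle terms are compared in both directions,
    and the composite comparison differs from the identity by a map into the
    kernel. *)
Lemma factors_through_F_cover (A : pzRingType) (X K P K' P' M N : lmodType A)
    (f : {linear K -> P}) (g : {linear P -> M})
    (f' : {linear K' -> P'}) (g' : {linear P' -> M}) :
  F_exact X f g -> F_exact X f' g' -> F_projective X P -> F_projective X P' ->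
  factors_through f N -> factors_through f' N.
Proof.
move=> ex ex' prP prP' fac u.
have [_ [f_inj fg_ex _] _] := ex; have [_ [f'_inj fg'_ex _] _] := ex'.
have [a aE] := F_projective_lift g prP ex'.
have [b bE] := F_projective_lift g' prP' ex.
have gf x : g (f x) = 0 by apply/fg_ex; exists x.
have [a1 a1E] : exists a1 : {linear K -> K'}, forall x, f' (a1 x) = a (f x).
  apply: (im_inverse (g := a \o f : {linear K -> P'}) f'_inj) => x.
  by apply/fg'_ex; rewrite /= aE gf.
have [b1 b1E] : exists b1 : {linear K' -> K}, forall x, f (b1 x) = b (f' x).
  apply: (im_inverse (g := b \o f' : {linear K' -> P}) f_inj) => x.
  by apply/fg_ex; rewrite /= bE; apply/fg'_ex; exists x.
have [d dE] : exists d : {linear P' -> K'}, forall x, f' (d x) = x - a (b x).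
  apply: (im_inverse (g := (idfun : {linear P' -> P'})
    - (a \o b : {linear P' -> P'})) f'_inj) => x.
  by apply/fg'_ex; rewrite /= linearB aE bE subrr.
have [w wE] := fac (u \o a1 : {linear K -> N}).
exists ((w \o b : {linear P' -> N}) + (u \o d : {linear P' -> N})) => x.
have df' : d (f' x) = x - a1 (b1 x).
  by apply: f'_inj; rewrite dE linearB a1E b1E.
by rewrite /= df' -b1E -wE linearB addrC subrK.
Qed.

Section Resolution.
Variables (A : pzRingType) (X M : lmodType A).
Implicit Types (P : F_resolution X M) (N Z : lmodType A).

Lemma syz_cover_surj P n z : exists y, syz_cover P n y = z.
Proof. by have [_ [_ _ surj] _] := syz_exact P n; apply: surj. Qed.

Lemma syz_cover_ker P n y :
  syz_cover P n y = 0 <-> exists x, bd P n.+1 x = y.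
Proof.
have [_ [_ ex _] _] := syz_exact P n; rewrite ex; split=> [[k <-]|[x <-]].
  by have [x <-] := syz_cover_surj k; exists x.
by exists (syz_cover P n.+1 x).
Qed.

Lemma bd_comp0 P n x : bd P n (bd P n.+1 x) = 0.
Proof.
rewrite /bd /=; have -> : syz_cover P n (bd P n.+1 x) = 0 by apply/syz_cover_ker; exists x.
exact: linear0.
Qed.

Lemma aug_bd P x : aug P (bd P 0 x) = 0.
Proof.
have [_ [_ ex _] _] := aug_exact P; apply/ex; by exists (syz_cover P 0 x).
Qed.

Lemma cocycle_coboundary_syz P N :
  (forall u : {linear term P 1 -> N}, cocycle u -> coboundary u)
    <-> factors_through (syz_in P 0) N.
Proof.
split=> [H u|fac u u0].
  have [|v vE] := H (u \o syz_cover P 0 : {linear term P 1 -> N}).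
    move=> x; rewrite /=; have -> : syz_cover P 0 (bd P 1 x) = 0.
      by apply/syz_cover_ker; exists x.
    exact: linear0.
  by exists v => z; have [x <-] := syz_cover_surj z; apply: vE.
have [|w wE] := factor_surjection (@syz_cover_surj P 0) (u := u).
  by move=> y /syz_cover_ker[x <-]; apply: u0.
by have [v vE] := fac w; exists v => x; rewrite -wE vE.
Qed.

(** By Schanuel's argument one resolution decides for all of them. *)
Lemma ExtF1_eq0 P N : ExtF_eq0 X 1 M N <-> factors_through (syz_in P 0) N.
Proof.
split=> [H|fac Q]; first exact/cocycle_coboundary_syz/H.
apply/cocycle_coboundary_syz; apply: factors_through_F_cover fac;
  by [exact: aug_exact|exact: term_proj].
Qed.

(** Vanishing on [P2] says that a map [P1 -> N] is induced from the syzygy, and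
    vanishing of [Ext^1] that the latter extends to [P0]. *)
Lemma factors_through_bd P N :
  factors_through (bd P 0) N
    <-> Hom_map_eq0 N (bd P 1) /\ ExtF_eq0 X 1 M N.
Proof.
rewrite (ExtF1_eq0 P N); split=> [fac|[hom0 fac] w]; [split=> [w x|u]|].
- by have [v ->] := fac w; rewrite bd_comp0 linear0.
- have [v vE] := fac (u \o syz_cover P 0 : {linear term P 1 -> N}).
  by exists v => z; have [x <-] := syz_cover_surj z; apply: vE.
have [|u uE] := factor_surjection (@syz_cover_surj P 0) (u := w).
  by move=> y /syz_cover_ker[x <-]; apply: hom0.
by have [v vE] := fac u; exists v => x; rewrite -uE vE.
Qed.

(** The lift to a power of [M] is available on [P1] but not on the syzygy, and
    on [P1] the factorization of maps into [M] applies to its components. *)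
Lemma factors_through_bd_genF P Z :
  factors_through (bd P 0) M -> in_genF X M Z -> ExtF_eq0 X 1 M Z.
Proof.
move=> fac [n [K [f [g ex]]]]; apply/(ExtF1_eq0 P) => u.
have [w wE] := F_projective_lift (u \o syz_cover P 0 : {linear term P 1 -> Z})
  (term_proj P 1) ex.
have /choice[v vE] : forall k, exists v : {linear term P 0 -> M},
    forall x, w x k = v (bd P 0 x).
  by move=> k; apply: (fac (copy_out M k \o w : {linear term P 1 -> M})).
exists (\sum_k (g \o copy_in M k \o v k : {linear term P 0 -> Z})) => z.
have [x <-] := syz_cover_surj z.
rewrite -[LHS]wE {1}(copies_coordinates (w x)) linear_sum lin_sumE.
by apply: eq_bigr => k _; rewrite /= vE.
Qed.

Lemma self_in_genF : fg M -> in_genF X M M.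
Proof.
move=> fgM; exists 1%N, (copies M 0), (\0 : {linear copies M 0 -> copies M 1}).
exists (copy_out M ord0 : {linear copies M 1 -> M}).
have inK x : copy_out M ord0 (copy_in M ord0 x : copies M 1) = x.
  by rewrite /= ffunE eqxx.
have ex : short_exact (\0 : {linear copies M 0 -> copies M 1}) (copy_out M ord0).
  split=> [x y _|y|z]; first by apply/ffunP => -[].
    split=> [y0|[x <-]]; last exact: linear0.
    exists 0; apply/ffunP => j; rewrite (ord1 j).
    by rewrite (y0 : y ord0 = 0) ffunE.
  by exists (copy_in M ord0 z).
split=> // [|Z _]; first by split=> //; apply: fg_copies.
apply: Hom_exact_of_lift => // w.
by exists (copy_in M ord0 \o w : {linear Z -> copies M 1}) => z; apply: inK.
Qed.

Lemma F_lift_through_aug P (Q : lmodType A) (w : {linear Q -> M}) : F_projective X Q ->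
  exists h : {linear Q -> term P 0}, forall x, aug P (h x) = w x.
Proof. by move=> prQ; apply: F_projective_lift prQ (aug_exact P). Qed.

Lemma aug_ker_lift P (Q : lmodType A) (h : {linear Q -> term P 0}) :
  F_projective X Q -> (forall x, aug P (h x) = 0) ->
  exists s : {linear Q -> term P 1}, forall x, bd P 0 (s x) = h x.
Proof.
move=> prQ h0; have [_ ex _] := aug_exact P.
have [k kE] := short_exact_lift ex h0.
have [s sE] := F_projective_lift k prQ (syz_exact P 0).
by exists s => x; rewrite /bd /= sE kE.
Qed.

(** Let [d] be the first differential.  Maps [h : P1 -> P0] up to maps of the
    form [d s] are the same as maps [P1 -> M], by composition with the
    augmentation, and the maps [t d] correspond to those that factor through
    [d]. *)
Lemma presilting_factors_through P :
  in_add X (term P 1) -> in_add X (term P 0) ->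
  F_presilting P <-> factors_through (bd P 0) M.
Proof.
move=> add1 add0; rewrite /F_presilting two_term_presilting //.
split=> [H w|fac h].
  have [h hE] := F_lift_through_aug P w (term_proj P 1).
  have [s [t stE]] := H h; exists (aug P \o t : {linear term P 0 -> M}) => x.
  by rewrite /= -hE stE linearD aug_bd add0r.
have [v vE] := fac (aug P \o h : {linear term P 1 -> M}).
have [t tE] := F_lift_through_aug P v (term_proj P 0).
have [s sE] : exists s : {linear term P 1 -> term P 1},
    forall x, bd P 0 (s x) = h x - t (bd P 0 x).
  apply: (aug_ker_lift (h := h - (t \o bd P 0 : {linear term P 1 -> term P 0})))
    (term_proj P 1) _ => x.
  by rewrite /= linearB tE -vE /= subrr.
by exists s, t => x; rewrite sE subrK.
Qed.

Lemma push_aug_surj P (w : homX X M) :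
  exists v : homX X (term P 0), push X (aug P) v = w.
Proof.
have [_ _ /(_ X (self_in_add X))[_ _ lift]] := aug_exact P.
by have [v vE] := lift w; exists v; apply: linear_ext.
Qed.

Lemma push_exact P : exact_at (push X (bd P 0)) (push X (aug P)).
Proof.
move=> u; split=> [u0|[v <-]]; last first.
  by apply: linear_ext => x /=; rewrite aug_bd.
have [_ ex _] := aug_exact P.
have [k kE] : exists k : {linear X -> syz P 0}, forall x, syz_in P 0 (k x) = u x.
  apply: (short_exact_lift ex) => x.
  exact: (congr1 (fun h : {linear X -> M} => h x) u0).
have [_ _ /(_ X (self_in_add X))[_ _ lift]] := syz_exact P 0.
have [v vE] := lift k; exists v; apply: linear_ext => x.
by rewrite /= vE kE.
Qed.
End Resolution.

Theorem proposition1p5 (R : comPzRingType) (L : pzRingType) (phi : alg_str R L)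
    (hL : artin_algebra phi)
    (J : lmodType R) (iota : {linear Rtop R -> J}) (hJ : injective_envelope iota)
    (X : lmodType L) (hX : additive_generator X)
    (M : lmodType L) (hM : fg M)
    (P : F_resolution X M) (hP : minimal_resolution P) :
  [<-> F_presilting P;
       Hom_map_eq0 M (bd P 1) /\ ExtF_eq0 X 1 M M;
       Hom_map_eq0 M (bd P 1) /\
         (forall Z : lmodType L, in_genF X M Z -> ExtF_eq0 X 1 M Z);
       tau_rigid (endop_alg phi X) J (homX X M : lmodType (endop X))].
Proof.
have addP n : in_add X (term P n) by apply: (F_projective_in_add hL); last exact: term_proj.
have [m1 [i1 [p1 ip1]]] := in_add_coordinates (addP 1%N).
have [m0 [i0 [p0 ip0]]] := in_add_coordinates (addP 0%N).
have [min_aug min_cover] := hP.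
have [injJ iota_inj _] := hJ.
have artR : artinian R by case: hL.
have fg1 := dual_basis_fg (push_dual_basis ip1).
have fg0 := dual_basis_fg (push_dual_basis ip0).
have pr1 := dual_basis_projective (push_dual_basis ip1).
have pr0 := dual_basis_projective (push_dual_basis ip0).
have pres : minimal_presentation (push X (bd P 0)) (push X (aug P)).
  split=> //.
  - by split; [apply: push_exact|apply: push_aug_surj].
  - apply: (push_right_minimal ip1); apply: right_minimal_comp_inj (min_cover 0%N).
    by have [_ [] ] := aug_exact P.
  - exact: (push_right_minimal ip0).
have facE : factors_through (push X (bd P 0)) (homX X M : lmodType (endop X))
    <-> factors_through (bd P 0) M by apply: factors_through_push ip1 ip0.
split; [|split; [|split]].
- by move/(presilting_factors_through (addP 1%N) (addP 0%N))/factors_through_bd.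
- move=> b; have [hom0 _] := b; split=> // Z.
  by apply: (factors_through_bd_genF (P := P)); apply/factors_through_bd.
- move=> [hom0 ext0]; split.
    by apply: fg_image (push_aug_surj P) fg0.
  have /facE fac : factors_through (bd P 0) M.
    by apply/factors_through_bd; split=> //; apply/ext0/self_in_genF.
  move=> Q1 Q0 f g fg_min.
  have [[fgQ1 prQ1] [fgQ0 prQ0] _ _ _] := fg_min.
  apply: factors_through_hom_tau0 => //.
  apply: (minimal_presentation_factors_through fg_min pr1 pr0 _ _ fac).
    exact: push_exact.
  exact: push_aug_surj.
- move=> [_ /(_ _ _ _ _ pres) tau0].
  apply/(presilting_factors_through (addP 1%N) (addP 0%N))/facE.
  exact: (hom_tau0_factors_through artR iota_inj injJ fg1 pr1 tau0).
Qed.
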